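(* Let $X$ and $Y$ be disjoint sets, let $u$ be an element of the free group $F$ on $X$ and $v$ an element of the free group $E$ on $Y$. Suppose that $u$ and $v$ are not proper powers and let $$G=\langle X\cup Y \mid [u,v]=1\rangle.$$ Then: (1) $G$ is residually a finite $p$-group for every prime $p$. (2) If $j,k\ge 1$ are integers such that $u\in\gamma_j(F)$, $u\notin\gamma_{j+1}(F)$, $v\in\gamma_k(E)$, $v\notin\gamma_{k+1}(E)$, and if $u$ is not a proper power modulo $\gamma_{j+1}(F)$ and $v$ is not a proper power modulo $\gamma_{k+1}(E)$, then $G$ is residually torsion-free nilpotent. In particular, if ($X$ and $Y$ are non-empty and finite and) $u$ is a basic commutator in $X$ and $v$ is a basic commutator in $Y$, then $G$ is residually torsion-free nilpotent.
   Context: Commutators: $[x,y]=x^{-1}y^{-1}xy$. The lower central series of a group $H$ is $\gamma_1(H)=H$, $\gamma_{n+1}(H)=[H,\gamma_n(H)]$. An element of a group is a proper power if it equals $w^m$ for some element $w$ of the group and some integer $m\ge 2$; an element $u\in\gamma_j(F)$ is a proper power modulo $\gamma_{j+1}(F)$ if $u\gamma_{j+1}(F)$ is a proper power in the abelian group $\gamma_j(F)/\gamma_{j+1}(F)$. For a class $\mathcal{P}$ of groups, a group $G$ is residually $\mathcal{P}$ if for each $g\in G$, $g\ne 1$, there is a normal subgroup $N$ of $G$ with $g\notin N$ and $G/N\in\mathcal{P}$; this is used for $\mathcal{P}$ the class of finite $p$-groups and for the class of torsion-free nilpotent groups. Basic commutators: let $S$ be a non-empty finite set and let $M$ be the free groupoid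 (free magma) on $S$, whose elements are the bracketed products of elements of $S$; the number of factors of $g\in M$ is its length (weight) $|g|$. A sequence $b_1,b_2,\dots$ of elements of $M$ is a basic sequence in $S$ if (1) every element of $S$ occurs in the sequence; (2) if $|b_i|<|b_j|$ then $i<j$; (3) an element $g=hl$ ($h,l\in M$) of length at least 2 occurs in the sequence if and only if $h=b_i$, $l=b_j$ with $j<i$, and either $|b_i|=1$ or $b_i=b_rb_s$ with $s\le j$. The terms of a basic sequence are called basic commutators in $S$; a basic commutator is regarded as an element of the free group on $S$ by interpreting the product $hl$ as the commutator $[h,l]$. *)

(* Defs.v *)
From HB Require Import structures.
From mathcomp Require Import all_boot.
From mathcomp Require Import boolp classical_sets functions cardinality.

Set Implicit Arguments.
Unset Strict Implicit.
Unset Printing Implicit Defensive.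

Local Open Scope classical_set_scope.
Local Open Scope card_scope.
Local Open Scope group_scope.

Section Subgroups.
Variable G : groupType.
Implicit Types (A B N : set G) (x y : G).

Definition is_subgroup A : Prop :=
  [/\ A 1, forall x y, A x -> A y -> A (x * y) & forall x, A x -> A x^-1].

Definition is_normal_subgroup A : Prop :=
  is_subgroup A /\ forall x y, A x -> A (x ^ y).

Definition comm_subgroup A B : set G :=
  smallest is_subgroup [set z | exists x y, [/\ A x, B y & z = [~ x, y]]].

(* Indexed from 1, so that [gamma 1 = setT]; [gamma 0] is a junk value. *)
Definition gamma (n : nat) : set G := iter n.-1 (comm_subgroup setT) setT.

Definition proper_power_in A x : Prop :=
  exists (w : G) (m : nat), [/\ A w, (2 <= m)%N & x = w ^+ m].

Definition proper_power x : Prop := proper_power_in setT x.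

Lemma smallest_subgroup A : is_subgroup (smallest is_subgroup A).
Proof.
split=> [B [[]]//|x y Ax Ay B BP|x Ax B BP].
  by have [[_ BM _] _] := BP; apply: BM; [apply: Ax|apply: Ay].
by have [[_ _ BV] _] := BP; apply: BV; apply: Ax.
Qed.

Lemma comm_subgroupT_normal A : is_normal_subgroup A ->
  is_normal_subgroup (comm_subgroup setT A).
Proof.
move=> [_ AJ]; split=> [|x y Cx]; first exact: smallest_subgroup.
have [C1 CM CV] := smallest_subgroup
  [set z | exists x y, [/\ [set: G] x, A y & z = [~ x, y]]].
pose B : set G := [set z | comm_subgroup setT A (z ^ y)].
apply: (Cx B); split.
  split=> [|a b Ba Bb|a Ba]; rewrite /B /=.
  - by rewrite conj1g.
  - by rewrite conjMg; apply: CM.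
  - by rewrite conjVg; apply: CV.
move=> _ [a [b [_ Ab ->]]]; rewrite /B /= conjRg => D [_]; apply.
by exists (a ^ y), (b ^ y); split=> //; apply: AJ.
Qed.

Lemma gamma_normal n : is_normal_subgroup (gamma n).
Proof.
rewrite /gamma; elim: n.-1 => [|m IHm]; first by split.
exact: comm_subgroupT_normal.
Qed.

Definition normal_closure A : set G := smallest is_normal_subgroup A.

Lemma normal_closure_normal A : is_normal_subgroup (normal_closure A).
Proof.
split; first split=> [B [[[]]]//|x y Ax Ay B BP|x Ax B BP].
- by have [[[_ BM _] _] _] := BP; apply: BM; [apply: Ax|apply: Ay].
- by have [[[_ _ BV] _] _] := BP; apply: BV; apply: Ax.
- by move=> x y Ax B BP; have [[_ BJ] _] := BP; apply: BJ; apply: Ax.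
Qed.

End Subgroups.
Arguments gamma G n : clear implicits.

Record normalSubgroup (G : groupType) := NormalSubgroup {
  nsg_set :> G -> Prop;
  nsgP : is_normal_subgroup nsg_set }.

Definition gammaN (G : groupType) (n : nat) : normalSubgroup G :=
  NormalSubgroup (gamma_normal G n).

Definition ncl (G : groupType) (R : set G) : normalSubgroup G :=
  NormalSubgroup (normal_closure_normal R).

Section Quotient.
Variables (G : groupType) (N : normalSubgroup G).

Let N1 : N 1. Proof. by case: (nsgP N) => -[]. Qed.
Let NM x y : N x -> N y -> N (x * y).
Proof. by case: (nsgP N) => -[_ NM _] _; apply: NM. Qed.
Let NV x : N x -> N x^-1.
Proof. by case: (nsgP N) => -[_ _ NV] _; apply: NV. Qed.
Let NJ x y : N x -> N (x ^ y).
Proof. by case: (nsgP N) => _; apply. Qed.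

Definition nsg_rel : rel G := fun x y => `[< N (x^-1 * y) >].

Lemma nsg_rel_equiv : equiv_class_of nsg_rel.
Proof.
apply: EquivClass => [x|x y|y x z].
- by apply/asboolP; rewrite mulVg.
- by apply/asboolP/asboolP => /NV; rewrite invgM invgK.
- move=> /asboolP Nxy /asboolP Nyz; apply/asboolP.
  by rewrite -(mulVKg y z) mulgA; apply: NM.
Qed.

Canonical nsg_equiv := EquivRelPack nsg_rel_equiv.

Definition quotg : Type := {eq_quot nsg_equiv}%qT.
HB.instance Definition _ := Choice.on quotg.
HB.instance Definition _ := EqQuotient.on quotg.

Definition qproj (x : G) : quotg := \pi_quotg%qT x.

Lemma qprojP x y : qproj x = qproj y <-> N (x^-1 * y).
Proof.
by split=> [/eqmodP/asboolP//|Nxy]; apply/eqmodP/asboolP.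
Qed.

Let qmul (a b : quotg) : quotg := qproj (repr a * repr b).
Let qinv (a : quotg) : quotg := qproj (repr a)^-1.

Let qreprK a : qproj (repr a) = a. Proof. exact: reprK. Qed.

Let qreprP x : N ((repr (qproj x))^-1 * x).
Proof. by apply/qprojP; rewrite qreprK. Qed.

Let qmulE x y : qmul (qproj x) (qproj y) = qproj (x * y).
Proof.
apply/qprojP; set a := repr _; set b := repr _.
have -> : (a * b)^-1 * (x * y) = (a^-1 * x) ^ b * (b^-1 * y).
  by rewrite invgM /conjg !mulgA mulgK.
by apply: NM; [apply: NJ|]; apply: qreprP.
Qed.

Let qinvE x : qinv (qproj x) = qproj x^-1.
Proof.
apply/qprojP; set a := repr _; rewrite invgK.
have -> : a * x^-1 = (a^-1 * x)^-1 ^ a^-1.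
  by rewrite /conjg invgM !invgK !mulgA mulgK.
by apply/NJ/NV/qreprP.
Qed.

Let qmulA : associative qmul.
Proof.
by move=> a b c; rewrite -(qreprK a) -(qreprK b) -(qreprK c) !qmulE mulgA.
Qed.
Let qmul1g : left_id (qproj 1) qmul.
Proof. by move=> a; rewrite -(qreprK a) qmulE mul1g. Qed.
Let qmulg1 : right_id (qproj 1) qmul.
Proof. by move=> a; rewrite -(qreprK a) qmulE mulg1. Qed.
Let qmulVg : left_inverse (qproj 1) qinv qmul.
Proof. by move=> a; rewrite -(qreprK a) qinvE qmulE mulVg. Qed.
Let qmulgV : right_inverse (qproj 1) qinv qmul.
Proof. by move=> a; rewrite -(qreprK a) qinvE qmulE mulgV. Qed.

HB.instance Definition _ :=
  isGroup.Build quotg qmulA qmul1g qmulg1 qmulVg qmulgV.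

Lemma qproj_is_monoid_morphism : monoid_morphism qproj.
Proof. by split=> // x y; rewrite -qmulE. Qed.
HB.instance Definition _ :=
  isUMagmaMorphism.Build G quotg qproj qproj_is_monoid_morphism.

End Quotient.
Arguments qproj {G} N x.

Definition residually (P : groupType -> Prop) (G : groupType) : Prop :=
  forall g : G, g <> 1 ->
    exists N : normalSubgroup G, ~ N g /\ P (quotg N).

Definition finite_pgroup (p : nat) (G : groupType) : Prop :=
  exists k : nat, [set: G] #= `I_(p ^ k)%N.

Definition torsion_free (G : groupType) : Prop :=
  forall (x : G) (n : nat), (0 < n)%N -> x ^+ n = 1 -> x = 1.

Definition nilpotent_group (G : groupType) : Prop :=
  exists n : nat, gamma G n.+1 = [set 1].

Definition torsion_free_nilpotent (G : groupType) : Prop :=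
  torsion_free G /\ nilpotent_group G.

(* The image of gamma_j in G / gamma_(j+1) is the group gamma_j / gamma_(j+1). *)
Definition proper_power_mod (G : groupType) (j : nat) (u : G) : Prop :=
  proper_power_in (qproj (gammaN G j.+1) @` gamma G j)
    (qproj (gammaN G j.+1) u).

(* The free group on [S], realised on reduced words: the letter [(s, true)]  *)
(* stands for the generator [s], and [(s, false)] for its inverse.           *)
Section FreeGroup.
Variable S : Type.

Definition letter : Type := ({classic S} * bool)%type.
HB.instance Definition _ := Choice.on letter.
Implicit Types (a b : letter) (s t w : seq letter).

Definition linv a : letter := (a.1, ~~ a.2).
Definition reduced w : bool := sorted (fun a b => b != linv a) w.

Lemma linvK : involutive linv.
Proof. by case=> x e; rewrite /linv /= negbK. Qed.

Definition consw a w : seq letter :=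
  if w is b :: w' then if b == linv a then w' else a :: w else [:: a].
Definition mulw s t : seq letter := foldr consw t s.
Definition invw s : seq letter := rev (map linv s).

Lemma reduced_behead a w : reduced (a :: w) -> reduced w.
Proof. exact: path_sorted. Qed.

Lemma reduced_consw a w : reduced w -> reduced (consw a w).
Proof.
case: w => //= b w; case: eqP => [_|/eqP ne_b]; first exact: path_sorted.
by move=> /= ->; rewrite ne_b.
Qed.

Lemma reduced_mulw s t : reduced t -> reduced (mulw s t).
Proof. by move=> rt; elim: s => //= a s; apply: reduced_consw. Qed.

Lemma reduced_invw s : reduced s -> reduced (invw s).
Proof.
rewrite /reduced /invw rev_sorted sorted_map; apply: sub_sorted => a b /=.
by rewrite linvK eq_sym.
Qed.

Lemma conswK a w : reduced w -> consw (linv a) (consw a w) = w.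
Proof.
case: w => /= [|b w]; first by rewrite linvK eqxx.
case: (b =P linv a) => [->|_]; last by rewrite /= linvK eqxx.
by case: w => //= c w /andP[/negPf->].
Qed.

Lemma mulw_consw a s t : reduced t -> mulw (consw a s) t = consw a (mulw s t).
Proof.
move=> rt; case: s => //= b s; case: eqP => // ->.
by rewrite -{1}(linvK a) conswK ?reduced_mulw.
Qed.

Lemma mulwA r s t : reduced t -> mulw (mulw r s) t = mulw r (mulw s t).
Proof. by move=> rt; elim: r => //= a r <-; rewrite mulw_consw. Qed.

Lemma mulw0 s : reduced s -> mulw s [::] = s.
Proof.
elim: s => // a s IHs ras; have rs := reduced_behead ras.
rewrite -[LHS]/(consw a (mulw s [::])) IHs //.
by case: s ras {IHs rs} => //= b s /andP[/negPf->].
Qed.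

Lemma mulwV s : mulw s (invw s) = [::].
Proof.
elim/last_ind: s => //= s a IHs.
by rewrite /invw map_rcons rev_rcons /mulw foldr_rcons /= eqxx.
Qed.

Lemma invwK : involutive invw.
Proof.
by move=> s; rewrite /invw map_rev revK -map_comp map_id_in // => a _; exact: linvK.
Qed.

Definition freeGroup : Type := {w : seq letter | reduced w}.
HB.instance Definition _ := Choice.on freeGroup.

Let fmul (x y : freeGroup) : freeGroup :=
  Sub (mulw (val x) (val y)) (reduced_mulw (val x) (valP y)).
Let finv (x : freeGroup) : freeGroup :=
  Sub (invw (val x)) (reduced_invw (valP x)).
Let fone : freeGroup := Sub [::] isT.

Let fmulA : associative fmul.
Proof. by move=> x y z; apply: val_inj; rewrite /= mulwA //; apply: valP. Qed.
Let fmul1 : left_id fone fmul. Proof. by move=> x; apply: val_inj. Qed.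
Let fmul1r : right_id fone fmul.
Proof. by move=> x; apply: val_inj; rewrite /= mulw0 //; apply: valP. Qed.
Let fmulV : right_inverse fone finv fmul.
Proof. by move=> x; apply: val_inj; rewrite /= mulwV. Qed.
Let fmulVl : left_inverse fone finv fmul.
Proof. by move=> x; apply: val_inj; rewrite /= -{2}[sval x]invwK mulwV. Qed.

HB.instance Definition _ :=
  isGroup.Build freeGroup fmulA fmul1 fmul1r fmulVl fmulV.

Definition fgen (x : S) : freeGroup := Sub [:: (x, true) : letter] isT.

Section Lift.
Variables (G : groupType) (f : S -> G).

Definition llift (a : letter) : G := if a.2 then f a.1 else (f a.1)^-1.
Definition wlift w : G := foldr (fun a x => llift a * x) 1 w.

Definition flift (x : freeGroup) : G := wlift (val x).

Lemma llift_linv a : llift (linv a) = (llift a)^-1.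
Proof. by case: a => x [] /=; rewrite /llift //= invgK. Qed.

Lemma wlift_consw a w : wlift (consw a w) = llift a * wlift w.
Proof.
case: w => //= b w; case: eqP => // ->.
by rewrite llift_linv mulVKg.
Qed.

Lemma flift_is_monoid_morphism : monoid_morphism flift.
Proof.
split=> // x y; rewrite /flift /=; elim: (sval x) => /= [|a s IHs].
  by rewrite mul1g.
by rewrite wlift_consw IHs mulgA.
Qed.
HB.instance Definition _ :=
  isUMagmaMorphism.Build freeGroup G flift flift_is_monoid_morphism.

Lemma flift_gen x : flift (fgen x) = f x.
Proof. by rewrite /flift /= /llift /= mulg1. Qed.

End Lift.
End FreeGroup.
Arguments fgen {S} x.

Lemma flift_uniq (S : Type) (G : groupType)
  (h : UMagmaMorphism.type (freeGroup S) G) (x : freeGroup S) :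
  h x = flift (h \o fgen) x.
Proof.
have wK w (rw : reduced w) : val (wlift (@fgen S) w) = w.
  elim: w rw => // -[y e] w IHw rw.
  have -> : val (wlift (@fgen S) ((y, e) :: w)) =
            consw (y, e) (val (wlift (@fgen S) w)) by case: e {rw}.
  rewrite (IHw (reduced_behead rw)).
  by case: w rw {IHw} => //= b w /andP[/negPf->].
have {1}<- : flift fgen x = x by apply: val_inj; apply/wK/valP.
rewrite /flift; elim: (val x) => [|[y e] w IHw] /=; first by rewrite gmulf1.
by rewrite gmulfM IHw; case: e; rewrite /llift //= gmulfV.
Qed.

Definition presented (S : Type) (R : set (freeGroup S)) : groupType :=
  quotg (ncl R).

Definition free_map (S T : Type) (f : S -> T) : freeGroup S -> freeGroup T :=
  flift (fgen \o f).

(* Disjointness of the two sets of generators is encoded by the sum type. *)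
Definition commuting_amalgam (X Y : Type) (u : freeGroup X) (v : freeGroup Y) :
    groupType :=
  @presented (X + Y)%type [set [~ free_map inl u, free_map inr v]].

Inductive magma (S : Type) : Type :=
| MLeaf of S
| MNode of magma S & magma S.

Fixpoint mweight (S : Type) (g : magma S) : nat :=
  if g is MNode h l then (mweight h + mweight l)%N else 1.

Fixpoint mcomm (S : Type) (g : magma S) : freeGroup S :=
  match g with
  | MLeaf x => fgen x
  | MNode h l => [~ mcomm h, mcomm l]
  end.

(* A finite or infinite sequence without repetitions, [b i = None] meaning   *)
(* that the sequence has no [i]-th term: basic sequences are infinite when   *)
(* [S] has at least two elements, but consist of one term when [S] has only  *)
(* one.                                                                      *)
Definition repetition_free_sequence (T : Type) (b : nat -> option T) : Prop :=
  (forall i j, (i <= j)%N -> b i = None -> b j = None) /\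
  (forall i j g, b i = Some g -> b j = Some g -> i = j).

Definition basic_sequence (S : Type) (b : nat -> option (magma S)) : Prop :=
  [/\ repetition_free_sequence b,
      forall x : S, exists i, b i = Some (MLeaf x),
      forall i j g h, b i = Some g -> b j = Some h ->
        (mweight g < mweight h)%N -> (i < j)%N
    & forall h l : magma S,
        (exists n, b n = Some (MNode h l)) <->
        exists i j, [/\ b i = Some h, b j = Some l, (j < i)%N &
          mweight h = 1%N \/
          exists r s hr hs, [/\ b r = Some hr, b s = Some hs,
            h = MNode hr hs & (s <= j)%N]]].

Definition basic_commutator (S : Type) (u : freeGroup S) : Prop :=
  exists b n g, [/\ @basic_sequence S b, b n = Some g & u = mcomm g].

(* Main.v *)
(* Let [K] be a field, and send each generator [x] to [1 + x] in the ring of  *)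
(* noncommutative power series (Magnus).  Adjoin a free variable eta to the   *)
(* series in [X], a free variable zeta to the series in [Y], and let the two  *)
(* rings commute with each other.  Write [U = u - 1] and [V = v - 1].         *)
(* Conjugating [F] by [1 + U zeta] and [E] by [1 + V eta] fixes [u] and [v],  *)
(* which commute, hence represents [G] by invertible series.  To first order, *)
(* [f] becomes [f + [U, f] zeta] and [e] becomes [e + [V, e] eta].            *)
(* An element of [G] is a word in [F] and [E], and a shortest one alternates  *)
(* and has no two adjacent syllables that centralize [u] and [v] (unless it   *)
(* has length 2): here one uses that the centralizers are <u> and <v>, as [u] *)
(* and [v] are not proper powers.  The part of highest degree in the isolated *)
(* zeta's and eta's is then the product of the [[U, f] zeta], the [[V, e] eta]*)
(* and the centralizing syllables, which is nonzero because power series form *)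
(* a domain.  So the representation is faithful, and the congruence subgroups *)
(* for the degree filtration, truncated to finitely many letters, have        *)
(* trivial intersection.  Their quotients are finite p-groups when [K] is the *)
(* field with p elements, and torsion-free nilpotent when [K] is the field of *)
(* rational numbers.                                                          *)

Require Import Defs.
From HB Require Import structures.
From mathcomp Require Import all_fingroup cyclic pgroup.
From mathcomp Require Import all_boot all_algebra.
From mathcomp Require Import zify.
From mathcomp Require Import boolp classical_sets functions cardinality.

Set Implicit Arguments.
Unset Strict Implicit.
Unset Printing Implicit Defensive.

Import GRing.Theory.
Local Open Scope ring_scope.

(** * Noncommutative power series *)

(** The amalgam is embedded in the units of a ring of power series, where congruence subgroups
    separate its elements. Over any domain [K] the Magnus map embeds both free groups ([mag_inj]),
    and conjugation by units commuting with [u] and with [v] keeps the relator trivial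
    ([rho_relator]) while separating the two factors otherwise.

    For faithfulness, an element is written with as few syllables from the two factors as possible.
    By [centralizer_power] and [geodesic_adj], two neighbouring syllables are never both central,
    except in words of length 2. The weight, a count of isolated marks, is then maximal in a product
    of an X-series and a Y-series ([rho_top], [topsE]). Both factors are nonzero there
    ([item_prod_coef]), whence [amalgam_rho_neq1].

    A nontrivial [g] thus gives a nonzero coefficient of [rho g - 1], at words in finitely many
    letters. The filtration by length of words in these letters has a congruence subgroup that
    misses [g] ([amalgam_separation]). The quotient is nilpotent because commutators add degrees
    ([gamma_congruence]). Over the rationals it is torsion-free ([congruence_torsion_free]); over
    the field with [p] elements it is finite of [p]-power exponent ([congruence_exponent],
    [word_filtration_finite]). *)

Section Series.
Variables (S : Type) (K : nzRingType).

Definition series : Type := seq S -> K.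
HB.instance Definition _ := GRing.Zmodule.copy series (seq S -> K).

Implicit Types (f g h : series) (w : seq S).

Definition sconst (c : K) : series := fun w => if w is [::] then c else 0.

(* The tail [fun t => f (x :: t)] is the left Brzozowski derivative of [f] by *)
(* [x]; this recursion is the Cauchy product over all splittings of the word. *)
Fixpoint smul f g w : K :=
  if w is x :: w' then f [::] * g w + smul (fun t => f (x :: t)) g w'
  else f [::] * g [::].

(** A coefficient of a product is a sum over the splittings of [w]; this principle stands in for
    that sum, for any property closed under addition. *)
Lemma smul_sum P f g w : P 0 -> (forall a b, P a -> P b -> P (a + b)) ->
  (forall w1 w2, w = w1 ++ w2 -> P (f w1 * g w2)) -> P (smul f g w).
Proof.
move=> P0 PD; elim: w f => [|x w IHw] f Pfg /=; first exact: (Pfg [::] [::]).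
apply: PD; first exact: (Pfg [::]).
by apply: IHw => w1 w2 eq_w; apply: (Pfg (x :: w1)); rewrite eq_w.
Qed.

Lemma smul_eq0 f g w : (forall w1 w2, w = w1 ++ w2 -> f w1 * g w2 = 0) ->
  smul f g w = 0.
Proof. by apply: (@smul_sum (fun z => z = 0)) => // a b -> ->;
  rewrite addr0. Qed.

Lemma smulDl f1 f2 g w : smul (f1 + f2) g w = smul f1 g w + smul f2 g w.
Proof.
elim: w f1 f2 => [|x w IHw] f1 f2 /=; first by rewrite mulrDl.
by rewrite mulrDl addrACA -IHw.
Qed.

Lemma smulDr f g1 g2 w : smul f (g1 + g2) w = smul f g1 w + smul f g2 w.
Proof.
elim: w f => [|x w IHw] f /=; first by rewrite mulrDr.
by rewrite mulrDr addrACA -IHw.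
Qed.

Lemma smulZl c f g w : smul (fun t => c * f t) g w = c * smul f g w.
Proof.
elim: w f => [|x w IHw] f /=; first by rewrite mulrA.
by rewrite mulrDr mulrA -IHw.
Qed.

Let smulA : associative (smul : series -> series -> series).
Proof.
move=> f g h; apply/funext => w; elim: w f g => [|x w IHw] f g /=.
  by rewrite mulrA.
rewrite {}IHw mulrDr mulrA -addrA; congr (_ + _).
by rewrite -smulZl -smulDl.
Qed.

Let smul1 : left_id (sconst 1) (smul : series -> series -> series).
Proof.
move=> f; apply/funext => -[|x w] /=; first by rewrite mul1r.
by rewrite mul1r smul_eq0 ?addr0 // => w1 w2 _; rewrite mul0r.
Qed.

Let smul1r : right_id (sconst 1) (smul : series -> series -> series).
Proof.
move=> f; apply/funext; move=> w; elim: w f => [|x w IHw] f /=;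
  first exact: mulr1.
by rewrite mulr0 add0r IHw.
Qed.

Let smulDl' : left_distributive (smul : series -> series -> series) +%R.
Proof. by move=> f g h; apply/funext => w; apply: smulDl. Qed.
Let smulDr' : right_distributive (smul : series -> series -> series) +%R.
Proof. by move=> f g h; apply/funext => w; apply: smulDr. Qed.
Let sone_neq0 : sconst 1 != 0 :> series.
Proof.
by apply/eqP => /(congr1 (@^~ [::])) /= /eqP; rewrite oner_eq0.
Qed.

HB.instance Definition _ := GRing.Zmodule_isNzRing.Build series
  smulA smul1 smul1r smulDl' smulDr' sone_neq0.

End Series.
Arguments sconst {S K} c.

Section SeriesTheory.
Variables (S : Type) (K : nzRingType).
Local Notation series := (series S K).
Implicit Types (f g h : series) (w : seq S).

Definition sderiv x f : series := fun t => f (x :: t).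

Lemma saddE f g w : (f + g) w = f w + g w. Proof. by []. Qed.
Lemma soppE f w : (- f) w = - f w. Proof. by []. Qed.
Lemma ssubE f g w : (f - g) w = f w - g w. Proof. by []. Qed.
Lemma s1E w : (1 : series) w = if w is [::] then 1 else 0. Proof. by []. Qed.
Lemma smulE0 f g : (f * g) [::] = f [::] * g [::]. Proof. by []. Qed.
Lemma smulE f g x w : (f * g) (x :: w) =
  f [::] * g (x :: w) + (sderiv x f * g) w.
Proof. by []. Qed.

Lemma smul_sumP P f g w : P 0 -> (forall a b, P a -> P b -> P (a + b)) ->
  (forall w1 w2, w = w1 ++ w2 -> P (f w1 * g w2)) -> P ((f * g) w).
Proof. exact: smul_sum. Qed.

Lemma smul0P f g w : (forall w1 w2, w = w1 ++ w2 -> f w1 * g w2 = 0) ->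
  (f * g) w = 0.
Proof. exact: smul_eq0. Qed.

(** Nonvanishing of a product is shown below by finding a word to which a single splitting
    contributes. *)
Lemma smul_unique f g w1 w2 :
  (forall a b, w1 ++ w2 = a ++ b -> a <> w1 -> f a * g b = 0) ->
  (f * g) (w1 ++ w2) = f w1 * g w2.
Proof.
elim: w1 f => [|x w1 IHw] f fg0 /=.
  case: w2 fg0 => [|y w2] //= fg0; rewrite smulE smul0P ?addr0 // => a b eq_w.
  by apply: (fg0 (y :: a)) => //=; rewrite eq_w.
rewrite smulE (fg0 [::]) // add0r IHw // => a b eq_w neq.
by apply: (fg0 (x :: a)); [rewrite /= eq_w|case].
Qed.

Lemma sconstM c f w : (sconst c * f) w = c * f w.
Proof.
case: w => [|x w] //; rewrite smulE smul0P ?addr0 // => w1 w2 _.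
by rewrite mul0r.
Qed.

Lemma smulC c f w : (f * sconst c) w = f w * c.
Proof.
have := @smul_unique f (sconst c) w [::]; rewrite cats0; apply=> a [|x b].
  by rewrite cats0 => ->.
by rewrite mulr0.
Qed.

Lemma sconst_is_additive : zmod_morphism (@sconst S K).
Proof.
by move=> c d; apply/funext => -[|x w] //=; rewrite ssubE /= ?subrr.
Qed.
Lemma sconst_is_multiplicative : monoid_morphism (@sconst S K).
Proof.
split=> // c d; apply/funext => w; rewrite sconstM.
by case: w => //= *; rewrite mulr0.
Qed.
HB.instance Definition _ :=
  GRing.isZmodMorphism.Build K series (@sconst S K) sconst_is_additive.
HB.instance Definition _ :=
  GRing.isMonoidMorphism.Build K series (@sconst S K) sconst_is_multiplicative.

Lemma sexp_eq0 f n w : f [::] = 0 -> (size w < n)%N -> (f ^+ n) w = 0.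
Proof.
move=> f0; elim: n w => // n IHn w lt_w; rewrite exprS; apply: smul0P.
case=> [|x w1] w2 eq_w; first by rewrite f0 mul0r.
by rewrite IHn ?mulr0 //; move: lt_w; rewrite eq_w size_cat /=; lia.
Qed.

(** The geometric series. Without constant term, [f ^+ i] vanishes on words shorter than [i], so at
    [w] the powers up to [size w] suffice and no convergence is involved. *)
Definition sgeom f : series := fun w => (\sum_(i < (size w).+1) f ^+ i) w.

Lemma ssumE (I : Type) (r : seq I) (P : pred I) (F : I -> series) w :
  (\sum_(i <- r | P i) F i) w = \sum_(i <- r | P i) F i w.
Proof. by apply: (big_morph (fun f : series => f w)). Qed.

Lemma sgeomE f n w : f [::] = 0 -> (size w <= n)%N ->
  sgeom f w = (\sum_(i < n.+1) f ^+ i) w.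
Proof.
move=> f0 le_w; rewrite /sgeom -(subnKC le_w).
elim: (n - size w)%N => [|m IHm]; first by rewrite addn0.
by rewrite addnS [in RHS]big_ord_recr /= saddE -IHm sexp_eq0 ?addr0 //
  ltnS leq_addr.
Qed.

Lemma mulr_sgeom f : f [::] = 0 -> (1 - f) * sgeom f = 1.
Proof.
move=> f0; apply/funext => w; pose s := \sum_(i < (size w).+1) f ^+ i.
rewrite -[sgeom f](subrK s) mulrDr saddE smul0P => [|w1 w2 eq_w]; last first.
  rewrite [(_ - s) _]ssubE (@sgeomE _ (size w)) ?subrr ?mulr0 // eq_w size_cat.
  exact: leq_addl.
rewrite add0r -opprB mulNr -subrX1 opprB ssubE sexp_eq0 ?subr0 //.
Qed.

Lemma mul_sgeomr f : f [::] = 0 -> sgeom f * (1 - f) = 1.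
Proof.
move=> f0; apply/funext => w; pose s := \sum_(i < (size w).+1) f ^+ i.
rewrite -[sgeom f](subrK s) mulrDl saddE smul0P => [|w1 w2 eq_w]; last first.
  rewrite [(_ - s) _]ssubE (@sgeomE _ (size w)) ?subrr ?mul0r // eq_w size_cat.
  exact: leq_addr.
have -> : s * (1 - f) = (1 - f) * s.
  apply/commrB; first exact: commr1.
  by apply: commr_sym; apply: commr_sum => i _; apply: commrX.
rewrite add0r -opprB mulNr -subrX1 opprB ssubE sexp_eq0 ?subr0 //.
Qed.

End SeriesTheory.

Section SeriesDomain.
Variables (S : Type) (K : idomainType).
Implicit Types f g : series S K.

Lemma series_neq0 (K' : nzRingType) (f : series S K') :
  f <> 0 -> exists w, f w <> 0.
Proof.
move=> f_neq0; apply/not_existsP => f0; apply: f_neq0; apply/funext => w.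
by have /contrapT := f0 w.
Qed.

Lemma series_order f : f <> 0 ->
  exists2 w, f w <> 0 & forall v, (size v < size w)%N -> f v = 0.
Proof.
move=> /series_neq0[w0 fw0].
have ex_n : exists n, `[< exists2 w, size w = n & f w <> 0 >].
  by exists (size w0); apply/asboolP; exists w0.
case: (ex_minnP ex_n) => n /asboolP[w <- fw] min_w; exists w => // v lt_v.
apply: contrapT => fv; suff: (size w <= size v)%N by lia.
by apply: min_w; apply/asboolP; exists v.
Qed.

(** For words [w] and [v] of least length in [f] and [g], any other splitting of [w ++ v] into the
    same lengths is impossible, and unequal lengths make one piece too short. *)
Lemma series_mulf_neq0 f g : f <> 0 -> g <> 0 -> f * g <> 0.
Proof.
move=> /series_order[w fw minf] /series_order[v gv ming].
move=> /(congr1 (fun h : series S K => h (w ++ v))).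
rewrite smul_unique => [/eqP|a b eq_wv neq_a].
  by rewrite mulf_eq0 => /orP[] /eqP.
have := congr1 size eq_wv; rewrite !size_cat => eq_size.
case: (ltngtP (size a) (size w)) => [/minf->|lt_w|eq_a]; first by rewrite mul0r.
  by rewrite ming ?mulr0 //; lia.
case: neq_a; have := congr1 (take (size w)) eq_wv.
by rewrite take_size_cat // -eq_a take_size_cat.
Qed.

End SeriesDomain.

Section SeriesSupport.
Variables (S : eqType) (K : nzRingType) (p : pred S).
Implicit Types f g : series S K.

Definition supported f : Prop := forall w, ~~ all p w -> f w = 0.

Lemma supportedD f g : supported f -> supported g -> supported (f + g).
Proof. by move=> pf pg w pw; rewrite saddE pf ?pg ?addr0. Qed.

Lemma supportedN f : supported f -> supported (- f).
Proof. by move=> pf w pw; rewrite soppE pf ?oppr0. Qed.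

Lemma supported1 : supported 1.
Proof. by move=> [|x w]. Qed.

Lemma supportedM f g : supported f -> supported g -> supported (f * g).
Proof.
move=> pf pg w pw; apply: smul0P => w1 w2 eq_w; move: pw.
rewrite eq_w all_cat negb_and => /orP[/pf->|/pg->]; first exact: mul0r.
exact: mulr0.
Qed.

Lemma supported_geom f : supported f -> supported (sgeom f).
Proof.
move=> pf w pw; rewrite /sgeom ssumE big1 // => i _.
suff: supported (f ^+ i) by apply.
elim: (i : nat) => [|n IHn]; first exact: supported1.
by rewrite exprS; apply: supportedM.
Qed.

End SeriesSupport.

Section SeriesVar.
Variables (S : eqType) (K : nzRingType).
Implicit Types f : series S K.

Definition svar (x : S) : series S K := fun w => (w == [:: x])%:R.

Lemma svar_mul0 x f : (svar x * f) [::] = 0.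
Proof. by rewrite smulE0 mul0r. Qed.

Lemma svar_mul x f y w : (svar x * f) (y :: w) = if y == x then f w else 0.
Proof.
rewrite smulE mul0r add0r; have [->|ne_yx] := eqVneq y x.
  suff -> : sderiv x (svar x) = 1 by rewrite mul1r.
  by apply/funext => -[|z t]; rewrite /sderiv /svar eqseq_cons eqxx.
suff -> : sderiv y (svar x) = 0 by rewrite mul0r.
by apply/funext => t; rewrite /sderiv /svar eqseq_cons (negPf ne_yx).
Qed.

Lemma supported_svar (p : pred S) x : p x -> supported p (svar x).
Proof. by move=> px w; rewrite /svar; case: eqP => // -> /=; rewrite px. Qed.

End SeriesVar.

(** * The group of units of a ring *)

Section Invertible.
Variable K : nzRingType.
Local Open Scope ring_scope.

(** A unit is stored together with its inverse, which makes the group operations explicit; the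
    inverse is determined by the value ([ival_inj]). *)
Definition invertible : Type :=
  {p : K * K | (p.1 * p.2 == 1) && (p.2 * p.1 == 1)}.
HB.instance Definition _ := Choice.on invertible.
Implicit Types x y z : invertible.

Definition inv_of (a b : K) (ab : a * b = 1) (ba : b * a = 1) : invertible :=
  Sub (a, b) (introT andP (conj (introT eqP ab) (introT eqP ba))).

Definition ival x : K := (val x).1.
Let iinv x : K := (val x).2.

Let ivalV x : ival x * iinv x = 1.
Proof. by case/andP: (valP x) => /eqP. Qed.
Let iVval x : iinv x * ival x = 1.
Proof. by case/andP: (valP x) => _ /eqP. Qed.

Lemma ival_inj : injective ival.
Proof.
move=> x y eq_xy; apply: val_inj; rewrite [val x]surjective_pairing.
rewrite [val y]surjective_pairing; congr (_, _) => //.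
have : iinv x = iinv y by rewrite -[RHS]mul1r -(iVval x) -mulrA eq_xy ivalV mulr1.
by [].
Qed.

Let imul_subproof x y : ival x * ival y * (iinv y * iinv x) = 1.
Proof. by rewrite mulrA -(mulrA (ival x)) ivalV mulr1 ivalV. Qed.
Let imul_subproof' x y : iinv y * iinv x * (ival x * ival y) = 1.
Proof. by rewrite mulrA -(mulrA (iinv y)) iVval mulr1 iVval. Qed.

Let imul x y := inv_of (imul_subproof x y) (imul_subproof' x y).
Let iV x := inv_of (iVval x) (ivalV x).
Let i1 := inv_of (mulr1 1) (mulr1 1).

Let imulA : associative imul.
Proof. by move=> x y z; apply: ival_inj; rewrite /ival /= mulrA. Qed.
Let imul1 : left_id i1 imul.
Proof. by move=> x; apply: ival_inj; rewrite /ival /= mul1r. Qed.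
Let imul1r : right_id i1 imul.
Proof. by move=> x; apply: ival_inj; rewrite /ival /= mulr1. Qed.
Let imulV : left_inverse i1 iV imul.
Proof. by move=> x; apply: ival_inj; apply: iVval. Qed.
Let imulVr : right_inverse i1 iV imul.
Proof. by move=> x; apply: ival_inj; apply: ivalV. Qed.

HB.instance Definition _ :=
  isGroup.Build invertible imulA imul1 imul1r imulV imulVr.

Lemma ivalM x y : ival (x * y)%g = ival x * ival y. Proof. by []. Qed.
Lemma ival1 : ival 1%g = 1. Proof. by []. Qed.
Lemma ivalK x : ival x * ival x^-1%g = 1. Proof. exact: ivalV. Qed.
Lemma ivalVK x : ival x^-1%g * ival x = 1. Proof. exact: iVval. Qed.

End Invertible.

(** * The Magnus representation *)

Section Runs.
Variable S : eqType.
Implicit Types (w : seq S) (x : S).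

(** The number of maximal blocks of equal letters. *)
Fixpoint runs w : nat :=
  if w is x :: w' then ((ohead w' != Some x) + runs w')%N else 0%N.

Lemma runs_cat w1 w2 : (runs (w1 ++ w2) <= runs w1 + runs w2)%N.
Proof.
elim: w1 => [|x [|y w1] IHw] //=; first by rewrite addn0 leq_add2r leq_b1.
by rewrite -addnA leq_add2l.
Qed.

Lemma runs_nseq_cat x n w : ohead w != Some x ->
  runs (nseq n.+1 x ++ w) = (runs w).+1.
Proof. by move=> xw; elim: n => [|n /= ->] /=; rewrite ?xw ?eqxx. Qed.

Lemma runs_pred1 x w : all (pred1 x) w -> (runs w <= 1)%N.
Proof.
move=> /all_pred1P->; case: (size w) => // n.
by have := @runs_nseq_cat x n [::] isT; rewrite cats0 => ->.
Qed.

End Runs.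

Section ReducedWords.
Variables (G : groupType) (T : Type) (e : T -> G).
Implicit Types L : seq T.
Local Open Scope group_scope.

Definition wprod L : G := foldr (fun s x => e s * x) 1 L.

Lemma wprod_cat L1 L2 : wprod (L1 ++ L2) = wprod L1 * wprod L2.
Proof. by elim: L1 => [|s L IHL] /=; rewrite ?mul1g // IHL mulgA. Qed.

(** Minimal length replaces normal forms. It serves twice: for products of powers of generators in a
    free group and for products of syllables in the amalgam. *)
Definition geodesic L : Prop :=
  forall L', wprod L' = wprod L -> (size L <= size L')%N.

Lemma geodesicP L : exists2 L', wprod L' = wprod L & geodesic L'.
Proof.
have exL : exists n, `[< exists2 L', size L' = n & wprod L' = wprod L >].
  by exists (size L); apply/asboolP; exists L.
case: (ex_minnP exL) => n /asboolP[L' <- eqL] minL; exists L' => // L2 eqL2.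
by apply: minL; apply/asboolP; exists L2 => //; rewrite eqL2.
Qed.

Lemma geodesic_neq1 L1 s L2 : geodesic (L1 ++ s :: L2) -> e s <> 1.
Proof.
move=> geoL es; suff: (size (L1 ++ s :: L2) <= size (L1 ++ L2))%N.
  by rewrite !size_cat /= addnS ltnn.
by apply: geoL; rewrite !wprod_cat /= es mul1g.
Qed.

Lemma geodesic_merge L1 s t L2 : geodesic (L1 ++ s :: t :: L2) ->
  ~ exists r, e r = e s * e t.
Proof.
move=> geoL [r er]; suff: (size (L1 ++ s :: t :: L2) <= size (L1 ++ r :: L2))%N.
  by rewrite !size_cat /= !addnS ltnn.
by apply: geoL; rewrite !wprod_cat /= er !mulgA.
Qed.

Lemma geodesic_tail s L : geodesic (s :: L) -> geodesic L.
Proof.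
move=> geoL L' eqL; suff: (size (s :: L) <= size (s :: L'))%N by [].
by apply: geoL; rewrite /= eqL.
Qed.

End ReducedWords.

Lemma freeGroup_ind (S : Type) (P : freeGroup S -> Prop) :
  P 1%g -> (forall x, P (fgen x)) -> (forall x y, P x -> P y -> P (x * y)%g) ->
  (forall x, P x -> P x^-1%g) -> forall x, P x.
Proof.
move=> P1 Pgen PM PV x.
have -> : x = flift fgen x by exact: (flift_uniq (@idfun (freeGroup S)) x).
rewrite /flift; elim: (val x) => //= -[y []] w IHw; apply: PM => //.
  exact: Pgen.
by apply: PV; apply: Pgen.
Qed.

Section Magnus.
Variables (X : Type) (K : idomainType).
Local Notation S := (option {classic X}).
Local Notation A := (series S K).
Implicit Types (f g : freeGroup X) (x : X) (w : seq S).

Let svarN0 (x : S) : (- svar K x) [::] = 0. Proof. exact: oppr0. Qed.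

(** The unit [1 + x] of Magnus. Generators are the letters [Some x]; the letter [None] is kept free
    for the mark. *)
Definition mag_gen (x : X) : invertible A :=
  inv_of (mulr_sgeom (svarN0 (Some x))) (mul_sgeomr (svarN0 (Some x))).

Definition mag f : A := ival (flift mag_gen f).

Lemma magM f g : mag (f * g)%g = mag f * mag g.
Proof. by rewrite /mag gmulfM ivalM. Qed.
Lemma mag1 : mag 1%g = 1. Proof. by rewrite /mag gmulf1. Qed.
Lemma magK f : mag f * mag f^-1%g = 1.
Proof. by rewrite -magM mulgV mag1. Qed.
Lemma magVK f : mag f^-1%g * mag f = 1.
Proof. by rewrite -magM mulVg mag1. Qed.

Lemma magE x : mag (fgen x) = 1 + svar K (Some x : S).
Proof. by rewrite /mag flift_gen /ival /= opprK. Qed.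

Lemma magVE x : mag (fgen x)^-1%g = sgeom (- svar K (Some x : S)).
Proof. by rewrite /mag gmulfV /= flift_gen. Qed.

Lemma mag_nil f : mag f [::] = 1.
Proof.
elim/freeGroup_ind: f => [|x|f g IHf IHg|f IHf].
- by rewrite mag1.
- by rewrite magE saddE addr0.
- by rewrite magM smulE0 IHf IHg mulr1.
- by have := congr1 (@^~ [::]) (magK f); rewrite /= smulE0 IHf mul1r.
Qed.

Lemma mag_supported f : supported isSome (mag f).
Proof.
suff []: supported isSome (mag f) /\ supported isSome (mag f^-1%g) by [].
elim/freeGroup_ind: f => [|x|f g [IHf IHVf] [IHg IHVg]|f [IHf IHVf]].
- by rewrite invg1 mag1; split; apply: supported1.
- rewrite magE magVE; split.
    by apply: supportedD; [apply: supported1|apply: supported_svar].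
  by apply/supported_geom/supportedN/supported_svar.
- by rewrite invgM !magM; split; apply: supportedM.
- by rewrite invgK.
Qed.

(** The top coefficient of [(1 + x)^n] is 1 in every characteristic, so nontrivial powers are
    detected without looking at other binomial coefficients. *)
Lemma mag_gen_pow x n :
  [/\ supported (pred1 (Some x : S)) (mag (fgen x ^+ n)%g),
      supported (pred1 (Some x : S)) (mag (fgen x ^- n)%g),
      mag (fgen x ^+ n)%g (nseq n (Some x)) = 1 &
      forall w, (n < size w)%N -> mag (fgen x ^+ n)%g w = 0].
Proof.
elim: n => [|n [IHn IHVn IHx IHw]].
  by rewrite !expg0 invg1 mag1; split=> //;
    [apply: supported1|apply: supported1|case].
rewrite expgS; split.
- rewrite magM magE; apply: supportedM => //.
  by apply: supportedD; [apply: supported1|apply: supported_svar;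
    rewrite /= eqxx].
- rewrite invgM magM magVE; apply: supportedM => //.
  by apply/supported_geom/supportedN/supported_svar; rewrite /= eqxx.
- rewrite magM magE mulrDl mul1r saddE IHw ?add0r /= ?size_nseq //.
  by rewrite svar_mul eqxx.
- case=> // y w lt_n; rewrite magM magE mulrDl mul1r saddE svar_mul.
  rewrite IHw ?add0r; last exact: ltnW.
  by case: ifP => // _; apply: IHw.
Qed.

Lemma mag_neq1 f : mag f <> 1 -> exists2 w, w <> [::] & mag f w <> 0.
Proof.
move=> f1; apply: contrapT => /forall2NP f0; apply/f1/funext => -[|y w].
  by rewrite mag_nil.
by have [/(_ (fun e => ltac:(discriminate e)))|/contrapT] := f0 (y :: w).
Qed.

(* [(x, n, true)] stands for [x ^+ n] and [(x, n, false)] for its inverse. *)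
Let syl : Type := {classic X} * nat * bool.
Let syl_val (s : syl) : freeGroup X :=
  if s.2 then (fgen s.1.1 ^+ s.1.2)%g else (fgen s.1.1 ^- s.1.2)%g.

Let syl_val_merge s t : s.1.1 = t.1.1 ->
  exists r, syl_val r = (syl_val s * syl_val t)%g.
Proof.
case: s t => [[x m] a] [[y n] b] /= <-.
have xC : commute (fgen x) (fgen x)^-1%g by apply: commuteV.
have subX (i j : nat) : exists r, syl_val r = (fgen x ^+ i * fgen x ^- j)%g.
  have [le_ij|le_ji] := leqP i j; last first.
    by exists (x, i - j, true)%N; rewrite /syl_val /= expgnFr // ltnW.
  exists (x, j - i, false)%N; rewrite /syl_val /= expgnFr // invgM invgK //.
case: a; case: b.
- by exists (x, m + n, true)%N; rewrite /syl_val /= expgnDr.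
- exact: subX.
- have [r er] := subX n m; exists r; rewrite er /syl_val /= -!expVgn.
  exact: commuteX2.
- by exists (x, n + m, false)%N; rewrite /syl_val /= expgnDr invgM.
Qed.

Let syl_val_supported s : supported (pred1 (Some s.1.1 : S)) (mag (syl_val s)).
Proof.
by case: s => [[x n] b]; have [? ? _ _] := mag_gen_pow x n; case: b.
Qed.

Let syl_val_neq1 s : syl_val s <> 1%g -> mag (syl_val s) <> 1.
Proof.
case: s => [[x n] b] s1.
have n0 : n != 0%N by apply/eqP => n0; apply: s1; rewrite n0; case: b;
  rewrite /syl_val /= ?invg1.
have [_ _ xn _] := mag_gen_pow x n.
have pow1 : mag (fgen x ^+ n)%g <> 1.
  move=> /(congr1 (@^~ (nseq n (Some x : S)))) /=; rewrite xn.
  by case: (n) n0 => // m _ /eqP; rewrite oner_eq0.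
case: b {s1} => // mag1'; apply: pow1.
by rewrite -[LHS]mulr1 -[X in _ * X]mag1' magK.
Qed.

(** Each syllable contributes at most one run. Taking a nonempty block from every syllable gives a
    word with exactly [size L] runs, as neighbouring blocks have different letters: equal ones would
    merge. *)
Let geodesic_mag (L : seq syl) : geodesic syl_val L ->
  [/\ forall w, (size L < runs w)%N -> mag (wprod syl_val L) w = 0 &
      exists w, [/\ runs w = size L, mag (wprod syl_val L) w <> 0
        & ohead w = if L is s :: _ then Some (Some s.1.1 : S) else None]].
Proof.
elim: L => [|s L IHL] geoL.
  rewrite mag1; split; first by case.
  by exists [::]; split=> //; apply/eqP; rewrite oner_eq0.
have [IHr [v [rv fv hv]]] := IHL (geodesic_tail geoL) => {IHL}.
have [w w0 fw] := mag_neq1 (syl_val_neq1 (geodesic_neq1 (L1 := [::]) geoL)).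
have sw : all (pred1 (Some s.1.1 : S)) w.
  by apply: contrapT => /negP/syl_val_supported.
have /all_pred1P eq_w := sw; case: (size w) eq_w => [//|n] eq_w.
have neq_v : ohead v != Some (Some s.1.1 : S).
  rewrite hv; case: L geoL {IHr rv fv hv} => // t L geoL; apply/eqP => -[eq_st].
  by apply: (geodesic_merge (L1 := [::]) geoL); apply: syl_val_merge.
rewrite /= magM; split=> [u lt_u|].
  apply: smul0P => a b eq_u; have [sa|/syl_val_supported->] :=
    boolP (all (pred1 (Some s.1.1 : S)) a); last exact: mul0r.
  rewrite IHr ?mulr0 //; have := runs_cat a b; rewrite -eq_u.
  by have := runs_pred1 sa; lia.
exists (w ++ v); split.
- by rewrite eq_w runs_nseq_cat // rv.
- rewrite smul_unique => [/eqP|a b eq_wv neq_a].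
    by rewrite mulf_eq0 => /orP[] /eqP.
  have [sa|/syl_val_supported->] := boolP (all (pred1 (Some s.1.1 : S)) a);
    last first.
    exact: mul0r.
  have /all_pred1P eq_a := sa; move: eq_wv neq_a;
    rewrite eq_w {w w0 fw sw eq_w}eq_a.
  (* A shorter [a] leaves part of the block in front of [v], hence one run too many in [b]; a longer
     [a] would force [v] to start with the letter of [s]. *)
  move: (size a) => m {a sa}; have [lt_mn|lt_nm|->//] := ltngtP m n.+1 =>
    eq_b _.
    have -> : b = nseq (n - m).+1 (Some s.1.1) ++ v.
      move: eq_b; rewrite -(subnKC lt_mn) addSn -addnS nseqD -catA => /eqP.
      by rewrite eqseq_cat // => /andP[_ /eqP <-]; rewrite subSS.
    by rewrite IHr ?mulr0 // runs_nseq_cat // rv.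
  case/eqP: neq_v; move/eqP: eq_b.
  by rewrite -(subnKC lt_nm) addSn -addnS nseqD -catA eqseq_cat // =>
    /andP[_ /eqP->].
- by rewrite eq_w.
Qed.

Lemma mag_inj : injective mag.
Proof.
suff mag1P f : mag f = 1 -> f = 1%g.
  move=> f g eq_fg; apply/eqP; rewrite -divg_eq1; apply/eqP/mag1P.
  by rewrite magM eq_fg magK.
suff [L <-] : exists L, wprod syl_val L = f.
  have [L' <- geoL'] := geodesicP syl_val L; case: L' geoL' =>
    // s L' geoL' eq1.
  have [_ [w [rw fw _]]] := geodesic_mag geoL'; case: fw; rewrite eq1.
  by case: w rw.
elim/freeGroup_ind: f => [|x|f g [L <-] [M <-]|f [L <-]].
- by exists [::].
- by exists [:: (x, 1%N, true)]; rewrite /= mulg1.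
- by exists (L ++ M); rewrite wprod_cat.
elim: L => [|s L [M eqM]]; first by exists [::]; rewrite /= invg1.
exists (M ++ [:: (s.1, ~~ s.2)]); rewrite wprod_cat /= mulg1 eqM invgM.
by congr (_ * _)%g; case: s => [[x n] []]; rewrite /syl_val //= invgK.
Qed.

End Magnus.

(** * Centralizers in free groups *)

Section FreeCentralizer.
Local Open Scope group_scope.

(** Euclid's algorithm on lengths: the shorter word is a prefix of the longer one, and removing it
    leaves a commuting pair. *)
Lemma cat_comm_pow (T : eqType) (s t : seq T) : s ++ t = t ++ s ->
  exists r m n, s = flatten (nseq m r) /\ t = flatten (nseq n r).
Proof.
have [k] := ubnP (size s + size t).
elim: k s t => // k IHk; suff wl (s t : seq T) : (size s <= size t)%N ->
    (size s + size t < k.+1)%N -> s ++ t = t ++ s ->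
    exists r m n, s = flatten (nseq m r) /\ t = flatten (nseq n r).
  move=> s t le_k eq_st; have [le_st|lt_ts] := leqP (size s) (size t).
    exact: wl.
  have [|r [m [n [-> ->]]]] := wl _ _ (ltnW lt_ts) _ (esym eq_st).
    by rewrite addnC.
  by exists r, n, m.
case: s => [|a s] le_st le_k eq_st.
  by exists t, 0%N, 1%N; rewrite /= cats0.
have eq_t : t = a :: s ++ drop (size (a :: s)) t.
  have := congr1 (take (size (a :: s))) eq_st.
  rewrite take_size_cat // takel_cat // => eq_s.
  by rewrite -{1}(cat_take_drop (size (a :: s)) t) -eq_s.
move: eq_st le_k; rewrite {le_st}eq_t; move: (drop _ t) => {}t;
  rewrite -cat_cons.
rewrite -catA => /eqP; rewrite eqseq_cat // eqxx /= => /eqP eq_st le_k.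
have [|r [m [n [eq_as eq_t]]]] := IHk (a :: s) t _ eq_st.
  move: le_k; rewrite /= size_cat; lia.
by exists r, m, (m + n)%N; rewrite -cat_cons nseqD flatten_cat -eq_as -eq_t.
Qed.

Variable S : Type.
Implicit Types (a b : letter S) (s t : seq (letter S)) (x y z : freeGroup S).

Definition is_power (G : groupType) (z x : G) : Prop :=
  exists n, x = z ^+ n \/ x = z ^- n.

Lemma is_powerV (G : groupType) (z x : G) : is_power z x^-1 -> is_power z x.
Proof.
by move=> [n [eq_x|/invg_inj eq_x]]; exists n; [right|left];
  rewrite // -eq_x invgK.
Qed.

Lemma is_powerJ (G : groupType) (z x y : G) : is_power z x -> is_power (z ^ y)
  (x ^ y).
Proof.
by move=> [n [->|->]]; exists n; [left|right]; rewrite ?conjVg conjXg.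
Qed.

Lemma wlift_val x : wlift fgen (val x) = x.
Proof. exact/esym/(flift_uniq (@idfun (freeGroup S))). Qed.

Lemma wlift_cat (G : groupType) (f : S -> G) s t :
  wlift f (s ++ t) = wlift f s * wlift f t.
Proof. by elim: s => [|a s IHs] /=; rewrite ?mul1g // IHs mulgA. Qed.

Lemma wlift_flatten (G : groupType) (f : S -> G) n s :
  wlift f (flatten (nseq n s)) = wlift f s ^+ n.
Proof. by elim: n => //= n IHn; rewrite wlift_cat IHn expgS. Qed.

Lemma size_mulw s t : (size (mulw s t) <= size s + size t)%N
  /\ (size (mulw s t) = (size s + size t)%N -> mulw s t = s ++ t).
Proof.
elim: s => [|a s [le_s eq_s]] //=; rewrite -/(mulw s t).
case eq_m: (mulw s t) le_s eq_s => [|b w] /= le_s eq_s.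
  by rewrite addSn; split=> // -[/eq_s<-].
case: eqP => [_|_]; first by split; lia.
by rewrite addSn; split=> // -[/eq_s<-].
Qed.

Lemma val_mulg x y : val (x * y) = mulw (val x) (val y).
Proof. by []. Qed.

Lemma mulw_reduced s t : reduced (s ++ t) -> mulw s t = s ++ t.
Proof.
elim: s => //= a s IHs ras; rewrite -/(mulw s t) IHs;
  last exact: reduced_behead ras.
by case: (s ++ t) ras => //= b w /andP[/negPf->].
Qed.

(** If nothing cancels in [x * y], then by length nothing cancels in [y * x], so the reduced words
    themselves commute. *)
Lemma commute_reduced x y : reduced (val x ++ val y) -> commute x y ->
  exists z, is_power z x /\ is_power z y.
Proof.
move=> red_xy xy.
have eq_xy : val x ++ val y = val y ++ val x.
  have eq1 : mulw (val y) (val x) = val x ++ val y.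
    by rewrite -(mulw_reduced red_xy) -!val_mulg xy.
  rewrite -eq1; apply: (size_mulw _ _).2.
  by rewrite eq1 size_cat addnC.
have [r [m [n [eq_x eq_y]]]] := cat_comm_pow eq_xy.
exists (wlift fgen r); split; [exists m|exists n]; left.
  by rewrite -wlift_flatten -eq_x wlift_val.
by rewrite -wlift_flatten -eq_y wlift_val.
Qed.

Lemma reduced_cat a s b t : reduced (a :: s) -> reduced (b :: t) ->
  ~~ reduced ((a :: s) ++ b :: t) -> b = linv (last a s).
Proof.
by rewrite /reduced /= cat_path /= => -> -> /=; rewrite andbT negbK => /eqP.
Qed.

Lemma linv_neq a : linv a != a.
Proof. by apply/eqP; case: a => y [] []. Qed.

(** If there is cancellation in [x * y], [y * x] and [x * y^-1], then [x] and [y] end in the same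
    letter and begin with its inverse. Conjugation by this letter shortens both. *)
Lemma commute_common_root x y : commute x y ->
  exists z, is_power z x /\ is_power z y.
Proof.
have [k] := ubnP (size (val x)); elim: k x y => // k IHk x y le_k xy.
have [red_xy|nred_xy] := boolP (reduced (val x ++ val y)).
  exact: commute_reduced red_xy xy.
have [red_yx|nred_yx] := boolP (reduced (val y ++ val x)).
  by have [z [zy zx]] := commute_reduced red_yx (commute_sym xy); exists z.
have [red_xVy|nred_xVy] := boolP (reduced (val x ++ val y^-1)).
  have [z [zx zy]] := commute_reduced red_xVy (commuteV xy).
  by exists z; split=> //; apply: is_powerV.
have Vy : val y^-1 = invw (val y) by [].
move: (valP x) (valP y) (valP y^-1) nred_xy nred_yx nred_xVy le_k.
rewrite Vy {Vy}; move: (wlift_val x) (wlift_val y).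
case: (val x) => [|c s].
  by move=> _ _ _ -> _ /negP.
case: (val y) =>
  [|b t] eq_x eq_y red_x red_y red_Vy nred_xy nred_yx nred_xVy le_k.
  by rewrite cats0 red_x in nred_xy.
have eq_b := reduced_cat red_x red_y nred_xy.
have eq_c := reduced_cat red_y red_x nred_yx.
have eq_a : last b t = last c s.
  move: nred_xVy red_Vy; rewrite (lastI b t) /invw map_rcons rev_rcons =>
    nred red_Vy.
  by apply: (can_inj (@linvK S)); apply: reduced_cat red_x red_Vy nred.
rewrite eq_a in eq_c; move: eq_x eq_y red_x red_y le_k eq_b eq_c eq_a.
case/lastP: s {nred_xy nred_yx nred_xVy} => [|s a] /=.
  by move=> _ _ _ _ _ _ /esym/eqP; rewrite (negPf (linv_neq c)).
rewrite last_rcons; case/lastP: t {red_Vy} => [|t a'] /=.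
  by move=> _ _ _ _ _ eq_b _ eq_ba; case/eqP: (linv_neq a); rewrite -eq_b.
rewrite last_rcons => eq_x eq_y red_x red_y le_k eq_b eq_c eq_a.
subst a' b c; move: eq_x eq_y.
rewrite -!cats1 !wlift_cat /= !mulg1 !llift_linv => eq_x eq_y.
have red_s w : reduced (linv a :: rcons w a) -> reduced w.
  by move/reduced_behead; rewrite -cats1 => /cat_sorted2[].
have wliftE w (red_w : reduced w) : wlift fgen w = Sub w red_w :> freeGroup S.
  exact: (wlift_val (Sub w red_w)).
move: eq_x eq_y; rewrite (wliftE _ (red_s _ red_x)) (wliftE _ (red_s _ red_y)).
move: (llift fgen a) => A; rewrite -!conjgE => eq_x eq_y.
have [||z [zx zy]] := IHk (Sub s (red_s _ red_x)) (Sub t (red_s _ red_y)).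
- by move: le_k; rewrite /= size_rcons; lia.
- by apply: (@conjg_inj _ A); rewrite !conjMg eq_x eq_y.
by exists (z ^ A); rewrite -eq_x -eq_y; split; apply: is_powerJ.
Qed.

Lemma centralizer_power x y : ~ proper_power x -> commute x y -> is_power x y.
Proof.
move=> npp /commute_common_root[z [[m eq_x] [n eq_y]]].
have [m2|] := leqP 2 m.
  case: npp; case: eq_x => ->; first by exists z, m.
  by exists z^-1, m; split; rewrite ?expVgn.
(* Exponent 0 is excluded because [1 = 1 ^+ 2] counts as a proper power. *)
case: m eq_x => [|[|//]] eq_x _.
  case: npp; exists 1, 2%N; split; rewrite ?expg1n //.
  by case: eq_x => ->; rewrite ?expg0 ?invg1.
have zx : z = x \/ z = x^-1 by case: eq_x => ->; rewrite !expg1 ?invgK;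
  [left|right].
exists n; case: zx eq_y => -> // []->; first by right; rewrite expVgn.
by left; rewrite expVgn invgK.
Qed.

End FreeCentralizer.

(** * Products of series separated by marks *)

Section IsolatedMarks.
Variable T : Type.
Implicit Types w v : seq (option T).

Definition isolated w : bool := sorted (fun a b => isSome a || isSome b) w.

Definition marks w : nat := count (fun a => ~~ isSome a) w.

Lemma isolated_cat w v : all isSome w -> isolated v -> isolated (w ++ v).
Proof.
elim: w => // -[a|] w IHw //= sw iv; have := IHw sw iv.
by rewrite /isolated /=; case: (w ++ v).
Qed.

Lemma marks_cat w v : all isSome w -> marks (w ++ v) = marks v.
Proof. by rewrite /marks; elim: w => //= -[a|] w IHw //= /IHw. Qed.

End IsolatedMarks.

Section OneSide.
Variables (X : Type) (K : idomainType) (u : freeGroup X).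
Local Notation S := (option {classic X}).
Local Notation A := (series S K).
Implicit Types (a b : A) (w v : seq S).

Definition mark : A := svar K None.

Definition nonconst a : Prop := exists2 w, w <> [::] & a w <> 0.

Lemma nonconst_neq0 a : nonconst a -> a <> 0.
Proof. by move=> [w _ aw] a0; rewrite a0 in aw. Qed.

Lemma neq0_nonconst a : a [::] = 0 -> a <> 0 -> nonconst a.
Proof. by move=> a0 /series_neq0[[|x w] aw //]; exists (x :: w). Qed.

(** As [a] has no marks, the first mark of the word fixes the splitting. *)
Lemma mul_mark_coef a b w v : supported isSome a -> all isSome w ->
  (a * mark * b) (w ++ None :: v) = a w * b v.
Proof.
move=> sa sw; rewrite -mulrA smul_unique => [|c d eq_cd neq_c].
  by rewrite svar_mul.
have [sc|/sa->] := boolP (all isSome c); last exact: mul0r.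
suff [d'] : exists d', ohead d = Some (Some d').
  by case: d {eq_cd} => // e d [->]; rewrite svar_mul mulr0.
elim: w c sw sc eq_cd neq_c => [|[x|] w IHw] [|[y|] c] //= sw sc.
  by move=> <- _; exists x.
by case=> eq_xy eq_cd neq_c; apply: (IHw c) => // eq_c; case: neq_c;
  rewrite eq_xy eq_c.
Qed.

(* [spaced c g a]: [a] is a product with [c] factors [mark], separated by     *)
(* series in the unmarked letters that are not constant, where [g] is the     *)
(* product of the factors preceding the first [mark].                         *)
Inductive spaced : nat -> A -> A -> Prop :=
| Spaced0 a : supported isSome a -> a <> 0 -> spaced 0 a a
| SpacedS a c b d : supported isSome a -> a <> 0 -> spaced c b d ->
    (c <> 0%N -> nonconst b) -> spaced c.+1 a (a * mark * d).

Lemma spaced_supp c a b : spaced c a b -> supported isSome a /\ a <> 0.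
Proof. by case. Qed.

Lemma spaced_mull c a b e : supported isSome e -> e <> 0 -> spaced c a b ->
  spaced c (e * a) (e * b).
Proof.
move=> se e0 [{}a sa a0|{}a {}c b' d sa a0 sp nc].
  by apply: Spaced0; [apply: supportedM|apply: series_mulf_neq0].
rewrite !mulrA; apply: SpacedS sp nc; first exact: supportedM.
exact: series_mulf_neq0.
Qed.

(** Nonempty words chosen in the factors between two marks keep the marks isolated; only after the
    last mark may the chosen word be empty. *)
Lemma spaced_coef c a b w : spaced c a b -> all isSome w -> a w <> 0 ->
  exists v, [/\ isolated v, marks v = c,
    v = [::] \/ c <> 0%N /\ ohead v = Some None & b (w ++ v) <> 0].
Proof.
move=> sp; elim: sp w => [{}a sa a0|{}a {}c b' d sa a0 sp IH nc] w sw aw.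
  by exists [::]; split; rewrite ?cats0 //; left.
have [s0 b0] := spaced_supp sp.
have [t bt t0] : exists2 t, b' t <> 0 & c <> 0%N -> t <> [::].
  have [->|/eqP c0] := eqVneq c 0%N; last by have [t ? ?] := nc c0; exists t.
  by have [t ?] := series_neq0 b0; exists t.
have st : all isSome t by apply: contrapT => /negP/s0.
have [v [iv mv hv dv]] := IH t st bt; exists (None :: t ++ v); split.
- have := isolated_cat st iv; case: t {bt dv} st t0 => [|[x|] t] //= _ t0.
  by case: hv => [->|[/t0]].
- by rewrite -mv -(marks_cat v st).
- by right.
- by rewrite mul_mark_coef // => /eqP; rewrite mulf_eq0 => /orP[] /eqP.
Qed.

(* [(Some f, c)] encodes an element [f] of the free group considered and      *)
(* [(None, c)] an element of the other one; [c] tells whether it is central.  *)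
Definition item : Type := option (freeGroup X) * bool.
Implicit Types (s t : item) (L : seq item).

(** What a syllable contributes to the part of top weight, seen on one side: [[U, f] = u f - f u]
    for a noncentral element of this side, and the mark for a noncentral element of the other
    side. *)
Definition item_val s : A :=
  match s with
  | (Some f, true) => mag K f
  | (Some f, false) => mag K u * mag K f - mag K f * mag K u
  | (None, true) => 1
  | (None, false) => mark
  end.

Definition item_ok s : Prop :=
  match s with
  | (Some f, true) => f <> 1%g
  | (Some f, false) => ~ commute u f
  | (None, _) => True
  end.

Definition item_adj : rel item :=
  fun s t => (isSome s.1 != isSome t.1) && ~~ (s.2 && t.2).

Definition item_prod L : A := foldr (fun s a => item_val s * a) 1 L.

Lemma item_val_nonconst f c : item_ok (Some f, c) ->
  supported isSome (item_val (Some f, c)) /\ nonconst (item_val (Some f, c)).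
Proof.
have sm := mag_supported K; case: c => /= ok; split=> //.
- by apply: mag_neq1 => f1; apply: ok; apply: (@mag_inj _ K); rewrite f1 mag1.
- by apply: supportedD; [|apply: supportedN]; apply: supportedM.
- apply: neq0_nonconst; first by rewrite ssubE !smulE0 !mag_nil subrr.
  move=> /eqP; rewrite subr_eq0 -!magM => /eqP/mag_inj; exact: ok.
Qed.

(** The clause on the head makes blocks between marks nonconstant. A central [f] is followed by a
    mark or by nothing, so its block is [mag K f] alone; a noncentral one has zero constant term,
    which persists in the product. *)
Lemma item_prod_spaced L : sorted item_adj L -> (forall s, s \in L ->
  item_ok s) ->
  exists a, spaced (count_mem (None, false) L) a (item_prod L) /\
    match L with
    | [::] => a = 1
    | (Some _, _) :: _ => nonconst a
    | (None, false) :: _ => a = 1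
    | _ => True
    end.
Proof.
have s1 : supported isSome (1 : A) by exact: supported1.
have n1 : 1 <> 0 :> A by apply/eqP; rewrite oner_eq0.
elim: L => [_ _|[[f|] c] L IHL] /=; first by exists 1; split=> //;
  apply: Spaced0.
  move=> sL ok; have [||a [sp eq_a]] := IHL; first exact: path_sorted sL.
    by move=> s sL'; apply: ok; rewrite inE sL' orbT.
  have [|sf nf] := @item_val_nonconst f c; first by apply: ok; rewrite mem_head.
  exists (item_val (Some f, c) * a); rewrite add0n; split.
    by apply: spaced_mull => //; apply: nonconst_neq0.
  case: c ok sL sf nf => ok sL sf nf.
    suff -> : a = 1 by rewrite mulr1.
    by case: L sL sp eq_a {IHL ok} => // -[[g|] []] L /=.
  have [_ a0] := spaced_supp sp; apply: neq0_nonconst.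
    by rewrite smulE0 /= ssubE !smulE0 !mag_nil subrr mul0r.
  by apply: series_mulf_neq0 => //; apply: nonconst_neq0.
move=> sL ok; have [||a [sp eq_a]] := IHL; first exact: path_sorted sL.
  by move=> s sL'; apply: ok; rewrite inE sL' orbT.
case: c ok sL => ok sL /=; first by exists a; rewrite mul1r.
exists 1; split=> //; rewrite -[mark]mul1r; apply: SpacedS sp _ => //.
by case: L sL eq_a {IHL ok} => // -[[g|] []].
Qed.

Lemma item_prod_coef L : sorted item_adj L -> (forall s, s \in L ->
  item_ok s) ->
  exists w, [/\ isolated w, marks w = count_mem (None, false) L &
    item_prod L w <> 0].
Proof.
move=> sL ok; have [a [sp _]] := item_prod_spaced sL ok.
have [sa /series_neq0[w aw]] := spaced_supp sp.
have sw : all isSome w by apply: contrapT => /negP/sa.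
have [v [iv mv _ bv]] := spaced_coef sp sw aw; exists (w ++ v); split=> //.
  exact: isolated_cat.
by rewrite marks_cat.
Qed.

End OneSide.

(** * The representation of the amalgam *)

Section SeriesMap.
Variables (S : Type) (K L : nzRingType) (h : {rmorphism K -> L}).
Implicit Types f g : series S K.

Definition smap f : series S L := fun w => h (f w).

Lemma smapM f g : smap (f * g) = smap f * smap g.
Proof.
apply/funext => w; elim: w f => [|x w IHw] f;
  first by rewrite /smap smulE0 rmorphM.
by rewrite /smap !smulE rmorphD rmorphM; congr (_ + _); apply: IHw.
Qed.

Lemma smapB f g : smap (f - g) = smap f - smap g.
Proof. by apply/funext => w; rewrite /smap ssubE rmorphB. Qed.

Lemma smap1 : smap 1 = 1.
Proof. by apply/funext => -[|x w]; rewrite /smap s1E ?rmorph1 ?rmorph0. Qed.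

End SeriesMap.

HB.instance Definition _ (S T : Type) (f : S -> T) :=
  UMagmaMorphism.copy (free_map f) (flift (@fgen T \o f)).

Lemma free_map_gen (S T : Type) (f : S ->
  T) x : free_map f (fgen x) = fgen (f x).
Proof. exact: flift_gen. Qed.

Section Representation.
Variables (X Y : Type) (K : idomainType) (u : freeGroup X) (v : freeGroup Y).
Local Notation SX := (option {classic X}).
Local Notation SY := (option {classic Y}).
Local Notation A := (series SX K).
Local Notation B := (series SY K).
Local Notation R := (series SY A).
Implicit Types (a : A) (b : B) (r : R).

(** [R] consists of series in the Y-letters over the series in the X-letters. X-series enter as
    constants and Y-series through their scalar coefficients, so the two images commute. *)
Definition lser a : R := sconst a.
Definition rser b : R := smap (sconst : {rmorphism K -> A}) b.

Lemma lserM a a' : lser (a * a') = lser a * lser a'. Proof. exact: rmorphM. Qed.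
Lemma lserB a a' : lser (a - a') = lser a - lser a'. Proof. exact: rmorphB. Qed.
Lemma lser1 : lser 1 = 1. Proof. by []. Qed.
Lemma rserM b b' : rser (b * b') = rser b * rser b'. Proof. exact: smapM. Qed.
Lemma rserB b b' : rser (b - b') = rser b - rser b'. Proof. exact: smapB. Qed.
Lemma rser1 : rser 1 = 1. Proof. exact: smap1. Qed.

Lemma lrserE a b w t : (lser a * rser b) w t = a t * b w.
Proof. by rewrite sconstM smulC. Qed.

Lemma lrserC a b : lser a * rser b = rser b * lser a.
Proof.
apply/funext => w; apply/funext => t.
by rewrite lrserE smulC sconstM mulrC.
Qed.

Lemma lrserM a a' b b' :
  lser a * rser b * (lser a' * rser b') = lser (a * a') * rser (b * b').
Proof. by rewrite lserM rserM -!mulrA (mulrA (rser b)) -lrserC -!mulrA. Qed.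

Lemma lmulE a r w t : (lser a * r) w t = (a * r w) t.
Proof. by rewrite sconstM. Qed.

Let U : A := mag K u - 1.
Let V : B := mag K v - 1.
Let markX : A := @mark X K.
Let markY : B := @mark Y K.

Let nilP : (- (lser U * rser markY)) [::] = 0.
Proof.
by rewrite soppE smulE0 (_ : rser _ _ = 0) ?mulr0 ?oppr0 //; apply: rmorph0.
Qed.
Let nilQ : (- (lser markX * rser V)) [::] = 0.
Proof.
by rewrite soppE smulE0 /rser /smap /V ssubE mag_nil subrr rmorph0 mulr0 oppr0.
Qed.

(** Here [markY] is zeta and [markX] is eta: each conjugator takes its mark from the other side, so
    that the mark commutes with [U], respectively [V]. *)
Let P : invertible R := inv_of (mulr_sgeom nilP) (mul_sgeomr nilP).
Let Q : invertible R := inv_of (mulr_sgeom nilQ) (mul_sgeomr nilQ).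

Let PE : ival P = 1 + lser U * rser markY.
Proof. by rewrite /ival /= opprK. Qed.
Let QE : ival Q = 1 + lser markX * rser V.
Proof. by rewrite /ival /= opprK. Qed.

Let lunit_subproof f : lser (mag K f) * lser (mag K f^-1%g) = 1.
Proof. by rewrite -lserM magK. Qed.
Let lunit_subproof' f : lser (mag K f^-1%g) * lser (mag K f) = 1.
Proof. by rewrite -lserM magVK. Qed.
Let runit_subproof f : rser (mag K f) * rser (mag K f^-1%g) = 1.
Proof. by rewrite -rserM magK rser1. Qed.
Let runit_subproof' f : rser (mag K f^-1%g) * rser (mag K f) = 1.
Proof. by rewrite -rserM magVK rser1. Qed.

Definition lunit (f : freeGroup X) : invertible R :=
  inv_of (lunit_subproof f) (lunit_subproof' f).
Definition runit (e : freeGroup Y) : invertible R :=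
  inv_of (runit_subproof e) (runit_subproof' e).

Let lunitM f g : lunit (f * g)%g = (lunit f * lunit g)%g.
Proof. by apply: ival_inj; rewrite ivalM /ival /= magM lserM. Qed.
Let runitM f g : runit (f * g)%g = (runit f * runit g)%g.
Proof. by apply: ival_inj; rewrite ivalM /ival /= magM rserM. Qed.

(* [P] commutes with [u], so the images of [u] and [v] still commute; but the *)
(* mark in [P] is free over the series in [Y], so the images of [f] and of    *)
(* [v] commute only when [f] commutes with [u].                               *)
Definition rho_gen (s : X + Y) : invertible R :=
  match s with
  | inl x => (lunit (fgen x) ^ P^-1)%g
  | inr y => (runit (fgen y) ^ Q^-1)%g
  end.

Definition rho : freeGroup (X + Y) -> invertible R := flift rho_gen.
HB.instance Definition _ := UMagmaMorphism.copy rho (flift rho_gen).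

Lemma rho_inl f : rho (free_map inl f) = (lunit f ^ P^-1)%g.
Proof.
have lunit1 : lunit 1%g = 1%g by apply: ival_inj; rewrite /ival /= mag1.
elim/freeGroup_ind: f => [|x|f g IHf IHg|f IHf].
- by rewrite !gmulf1 lunit1 conj1g.
- by rewrite free_map_gen /rho flift_gen.
- by rewrite !gmulfM /= IHf IHg lunitM conjMg.
by rewrite !gmulfV /= IHf -conjVg; congr (_ ^ _)%g; apply: ival_inj.
Qed.

Lemma rho_inr e : rho (free_map inr e) = (runit e ^ Q^-1)%g.
Proof.
have runit1 : runit 1%g = 1%g by apply: ival_inj; rewrite /ival /= mag1 rser1.
elim/freeGroup_ind: e => [|x|f g IHf IHg|f IHf].
- by rewrite !gmulf1 runit1 conj1g.
- by rewrite free_map_gen /rho flift_gen.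
- by rewrite !gmulfM /= IHf IHg runitM conjMg.
by rewrite !gmulfV /= IHf -conjVg; congr (_ ^ _)%g; apply: ival_inj.
Qed.

Let mag_comm (f : freeGroup X) : commute u f -> GRing.comm (mag K f) U.
Proof. by move=> uf; apply: commrB;
  [rewrite /GRing.comm -!magM uf|apply: commr1]. Qed.
Let mag_comm' (e : freeGroup Y) : commute v e -> GRing.comm (mag K e) V.
Proof. by move=> uf; apply: commrB;
  [rewrite /GRing.comm -!magM uf|apply: commr1]. Qed.

Lemma rho_inl_central f : commute u f -> rho (free_map inl f) = lunit f.
Proof.
move=> uf; rewrite rho_inl; apply/eqP; rewrite conjg_fix; apply/commgP/commuteV.
apply: ival_inj; rewrite !ivalM PE /ival /= mulrDl mulrDr mulr1 mul1r;
  congr (_ + _).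
by rewrite mulrA -lserM mag_comm // lserM -!mulrA lrserC.
Qed.

Lemma rho_inr_central e : commute v e -> rho (free_map inr e) = runit e.
Proof.
move=> uf; rewrite rho_inr; apply/eqP; rewrite conjg_fix; apply/commgP/commuteV.
apply: ival_inj; rewrite !ivalM QE /ival /= mulrDl mulrDr mulr1 mul1r;
  congr (_ + _).
by rewrite -[RHS]mulrA -rserM -mag_comm' // rserM !mulrA lrserC.
Qed.

Lemma rho_relator : rho [~ free_map inl u, free_map inr v]%g = 1%g.
Proof.
rewrite gmulfR /= rho_inl_central // rho_inr_central //; apply/eqP/commgP.
by apply: ival_inj; rewrite !ivalM /ival /= lrserC.
Qed.

(* Pairs with adjacent marks get weight 0: this keeps [wt] subadditive while  *)
(* making the terms with two adjacent marks negligible, so that only the      *)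
(* first-order term in the mark of each conjugation counts.                   *)
Definition wt (w : seq SY) (t : seq SX) : nat :=
  if isolated w && isolated t then (marks w + marks t)%N else 0%N.

Lemma wt_cat w1 w2 t1 t2 :
  (wt (w1 ++ w2) (t1 ++ t2) <= wt w1 t1 + wt w2 t2)%N.
Proof.
rewrite /wt; case: ifP => // /andP[/cat_sorted2[iw1 iw2] /cat_sorted2[it1 it2]].
by rewrite /isolated iw1 iw2 it1 it2 /marks !count_cat addnACA.
Qed.

Definition weight_lt d r : Prop :=
  forall w t, (d <= wt w t)%N -> r w t = 0.

Lemma weight_ltW d e r : (d <= e)%N -> weight_lt d r -> weight_lt e r.
Proof. by move=> le_de rd w t le_e; apply: rd; apply: leq_trans le_e. Qed.

Lemma weight_ltD d r s : weight_lt d r -> weight_lt d s -> weight_lt d (r + s).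
Proof. by move=> rd sd w t le_d; rewrite !saddE rd ?sd ?addr0. Qed.

(** The bounds are strict: weights at most [d - 1] and [e - 1] add up to at most [d + e - 2]. *)
Lemma weight_ltM d e r s : weight_lt d r -> weight_lt e s ->
  weight_lt (d + e).-1 (r * s).
Proof.
move=> rd se w t le_de; apply: (smul_sumP (P := fun a : A => a t = 0)) => //.
  by move=> a b; rewrite saddE => -> ->; rewrite addr0.
move=> w1 w2 eq_w; apply: smul0P => t1 t2 eq_t.
have := wt_cat w1 w2 t1 t2; rewrite -eq_w -eq_t => wt_wt.
have [le_d|lt_d] := leqP d (wt w1 t1); first by rewrite rd ?mul0r.
by rewrite se ?mulr0 //; lia.
Qed.

Definition syll : Type := (freeGroup X + freeGroup Y)%type.
Implicit Types (s : syll) (L : seq syll).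

Definition central s : bool :=
  match s with inl f => `[< commute u f >] | inr e => `[< commute v e >] end.

Definition syll_word s : freeGroup (X + Y) :=
  match s with inl f => free_map inl f | inr e => free_map inr e end.

Definition left_item s : item X :=
  match s with inl f => (Some f, central s) | inr _ => (None, central s) end.

Definition right_item s : item Y :=
  match s with inl _ => (None, central s) | inr e => (Some e, central s) end.

Definition syll_top s : R :=
  lser (item_val K u (left_item s)) * rser (item_val K v (right_item s)).

Lemma syll_top_central s : central s -> ival (rho (syll_word s)) = syll_top s.
Proof.
rewrite /syll_top; case: s => [f|e] /= /[dup] cs -> /=.
  by rewrite rho_inl_central; [rewrite rser1 mulr1|apply/asboolP].
by rewrite rho_inr_central; [rewrite lser1 mul1r|apply/asboolP].
Qed.


Lemma wt_unmarked w t : all isSome w -> all isSome t -> wt w t = 0%N.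
Proof.
move=> sw st; rewrite /wt; case: ifP => // _.
by rewrite -(cats0 w) -(cats0 t) !marks_cat.
Qed.

Lemma weight_lt_lser a : supported isSome a -> weight_lt 1 (lser a).
Proof.
move=> sa [|y w] t // lt_t; apply: sa; apply/negP => st.
by rewrite wt_unmarked in lt_t.
Qed.

Lemma weight_lt_rser b : supported isSome b -> weight_lt 1 (rser b).
Proof.
move=> sb w t lt_t; have [sw|/sb bw] := boolP (all isSome w); last first.
  by rewrite /rser /smap bw rmorph0.
by case: t lt_t => // lt_t; rewrite wt_unmarked in lt_t.
Qed.

Lemma rser_mark : rser markY = svar A (None : SY).
Proof. by apply/funext => w; apply: rmorph_nat. Qed.

(** Only words starting with two adjacent marks occur, and these have weight 0. *)
Lemma weight_lt_markY r : weight_lt 1 (rser (markY * markY) * r).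
Proof.
rewrite rserM rser_mark -mulrA => w t lt_w.
have nbad z : w <> None :: None :: z by move=> eq_w; rewrite eq_w in lt_w.
case: w lt_w nbad => [|y w] _ nbad; first by rewrite svar_mul0.
rewrite svar_mul; case: eqP nbad => // ->.
case: w => [|z w] nbad; first by rewrite svar_mul0.
by rewrite svar_mul; case: eqP nbad => // -> /(_ w).
Qed.

Lemma weight_lt_markX r : weight_lt 1 (lser (markX * markX) * r).
Proof.
move=> w t lt_w; rewrite lmulE -mulrA.
have nbad z : t <> None :: None :: z.
  by move=> eq_t; rewrite eq_t /wt /= andbF in lt_w.
case: t lt_w nbad => [|y t] _ nbad; first by rewrite svar_mul0.
rewrite svar_mul; case: eqP nbad => // ->.
case: t => [|z t] nbad; first by rewrite svar_mul0.
by rewrite svar_mul; case: eqP nbad => // -> /(_ t).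
Qed.

Lemma weight_ltMl a r : weight_lt 1 r -> supported isSome a ->
  weight_lt 1 (lser a * r).
Proof. by move=> r1 sa; apply: (weight_ltM (d := 1) (e := 1)) => //;
  apply: weight_lt_lser. Qed.

Lemma weight_ltMr b r : weight_lt 1 r -> supported isSome b ->
  weight_lt 1 (rser b * r).
Proof. by move=> r1 sa; apply: (weight_ltM (d := 1) (e := 1)) => //;
  apply: weight_lt_rser. Qed.

(** From [p x = x p + d] follows [p x p^-1 = x + d p^-1], and [p^-1 = 1 - z p^-1]. *)
Lemma conj_expand (p x : invertible R) (z : R) : ival p = 1 + z ->
  let d := z * ival x - ival x * z in
  ival (x ^ p^-1)%g = ival x + d - d * z * ival p^-1%g.
Proof.
move=> eq_p d; have eq_pV : z * ival p^-1%g = 1 - ival p^-1%g.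
  by rewrite -[X in X - _](ivalK p) eq_p mulrDl mul1r addrAC subrr add0r.
have eq_d : d * ival p^-1%g =
    z * ival x * ival p^-1%g - (ival x - ival x * ival p^-1%g).
  by rewrite mulrBl -[_ * z * _]mulrA eq_pV mulrBr mulr1.
have subKr' (a b c : R) : a + b - (b - c) = a + c.
  by rewrite opprB addrC [a + b]addrC addrA subrK addrC.
rewrite conjgE invgK !ivalM -[d * z * _]mulrA eq_pV mulrBr mulr1 subKr' eq_d.
rewrite mulrA eq_p mulrDl mul1r mulrDl opprB.
by rewrite [RHS]addrCA [ival x + _]addrC subrK addrC.
Qed.

Lemma weight_lt_rmark : weight_lt 2 (rser markY).
Proof.
rewrite rser_mark => w t; rewrite /svar; case: eqP => [->|_ _] //.
by case: t.
Qed.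

Lemma weight_lt_lmark : weight_lt 2 (lser markX).
Proof.
move=> [|y w] t // lt_t; rewrite /lser /= /markX /mark /svar.
by case: eqP lt_t => // ->.
Qed.

(** In the expansion of the conjugate, the zeroth-order term has no marks and the last term contains
    the square of a mark; both have weight 0. *)
Lemma syll_top_noncentral s : ~~ central s ->
  weight_lt 1 (ival (rho (syll_word s)) - syll_top s) /\ weight_lt 2 (syll_top s).
Proof.
have sX := mag_supported K (X := X); have sY := mag_supported K (X := Y).
have sU : supported isSome U.
  by apply: supportedD => //; apply: supportedN; apply: supported1.
have sV : supported isSome V.
  by apply: supportedD => //; apply: supportedN; apply: supported1.
have subKr' (a b c : R) : weight_lt 1 a -> weight_lt 1 c ->
  weight_lt 1 (a + b - c - b).
  by move=> a1 c1 w t /[dup] /a1 aw /c1 cw;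
    rewrite addrAC addrK ssubE ssubE aw cw subrr.
rewrite /syll_top; case: s => [f|e] ncs; rewrite /= in ncs *;
  rewrite (negPf ncs) /=.
  set a := mag K u * mag K f - _; have sa : supported isSome a.
    by apply: supportedD; [|apply: supportedN]; apply: supportedM.
  split; last exact: weight_ltM (weight_lt_lser sa) weight_lt_rmark.
  rewrite rho_inl (conj_expand _ PE).
  have -> : lser U * rser markY * ival (lunit f) -
      ival (lunit f) * (lser U * rser markY)
          = lser a * rser markY.
    rewrite /ival /= -mulrA -lrserC !mulrA -!lserM -mulrBl -lserB.
    by rewrite mulrBl mulrBr mul1r mulr1 opprB addrA subrK.
  apply: subKr'; first exact: weight_lt_lser.
  rewrite lrserM -mulrA; apply: weight_ltMl; last exact: supportedM.
  exact: weight_lt_markY.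
set b := mag K v * mag K e - _; have sb : supported isSome b.
  by apply: supportedD; [|apply: supportedN]; apply: supportedM.
split; last exact: weight_ltM weight_lt_lmark (weight_lt_rser sb).
rewrite rho_inr (conj_expand _ QE).
have -> : lser markX * rser V * ival (runit e) -
    ival (runit e) * (lser markX * rser V)
        = lser markX * rser b.
  rewrite /ival /= mulrA -lrserC -!mulrA -!rserM -mulrBr -rserB.
  by rewrite mulrBl mulrBr mul1r mulr1 opprB addrA subrK.
apply: subKr'; first exact: weight_lt_rser.
rewrite lrserM lrserC -mulrA; apply: weight_ltMr; last exact: supportedM.
exact: weight_lt_markX.
Qed.

Definition degree L : nat := count (predC central) L.

Definition tops L : R := foldr (fun s r => syll_top s * r) 1 L.

(** In [(r' - syll_top s) * r + syll_top s * (r - tops L)], each summand has one factor whose weight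
    bound is lower by one. *)
Lemma rho_top L (r := ival (rho (wprod syll_word L))) :
  weight_lt (degree L) (r - tops L) /\ weight_lt (degree L).+1 (tops L).
Proof.
have syllP s : weight_lt (~~ central s)
  (ival (rho (syll_word s)) - syll_top s) /\
    weight_lt (~~ central s).+1 (syll_top s).
  have [cs|ncs] := boolP (central s); last exact: syll_top_noncentral.
  rewrite syll_top_central // subrr; split=> //; rewrite /syll_top.
  have sX := mag_supported K (X := X); have sY := mag_supported K (X := Y).
  apply: (weight_ltM (d := 1) (e := 1)).
    by apply: weight_lt_lser; case: s cs => /= [f|f] -> //; apply: supported1.
  by apply: weight_lt_rser; case: s cs => /= [f|f] -> //; apply: supported1.
rewrite {}/r; elim: L => [|s L [IHr IHt]].
  rewrite /= gmulf1 ival1 subrr; split=> //.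
  exact: (@weight_lt_lser 1 (@supported1 _ _ _)).
have [s1 s2] := syllP s; rewrite /degree /= -/(degree L) gmulfM ivalM.
set r := ival (rho (wprod _ L)); set r' := ival _.
split; last by have := weight_ltM s2 IHt; rewrite addSn addnS.
have -> : r' * r - syll_top s * tops L =
    (r' - syll_top s) * r + syll_top s * (r - tops L).
  by rewrite mulrBl mulrBr addrA subrK.
apply: weight_ltD; last by have := weight_ltM s2 IHr; rewrite addSn.
have rW : weight_lt (degree L).+1 r.
  by rewrite -[r](subrK (tops L)); apply: weight_ltD => //;
    apply: weight_ltW IHr.
by have := weight_ltM s1 rW; rewrite addnS.
Qed.

Lemma topsE L : tops L =
  lser (item_prod K u (map left_item L)) * rser (item_prod K v (map right_item L)).
Proof. by elim: L => [|s L IHL] /=;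
  rewrite ?lser1 ?rser1 ?mul1r // IHL lrserM. Qed.

Definition same_side (s t : syll) : bool :=
  match s, t with inl _, inl _ | inr _, inr _ => true | _, _ => false end.

Definition syll_adj : rel syll :=
  fun s t : syll => ~~ same_side s t && ~~ (central s && central t).

Definition nontrivial (s : syll) : Prop :=
  match s with inl f => f <> 1%g | inr e => e <> 1%g end.

Lemma rho_coef L : sorted syll_adj L ->
  (forall s, s \in L -> nontrivial s) ->
  exists w t, (degree L <= wt w t)%N /\ ival (rho (wprod syll_word L)) w t <> 0.
Proof.
move=> sL nt.
have [||t [it mt ft]] := @item_prod_coef X K u (map left_item L).
- by rewrite sorted_map; apply: sub_sorted sL => -[f|f] [g|g].
- move=> _ /mapP[s /nt ns ->]; case: s ns => [f|e] //= f1.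
  by case: (boolP `[< commute u f >]) => // /asboolPn.
have [||w [iw mw fw]] := @item_prod_coef Y K v (map right_item L).
- by rewrite sorted_map; apply: sub_sorted sL => -[f|f] [g|g].
- move=> _ /mapP[s /nt ns ->]; case: s ns => [f|e] //= f1.
  by case: (boolP `[< commute v e >]) => // /asboolPn.
(* Each noncentral syllable yields exactly one mark, on the side opposite to its own. *)
have eq_d : wt w t = degree L.
  rewrite /wt iw it mt mw /degree; elim: (L) => //= -[f|e] M /= <-.
    by case: (boolP `[< commute u f >]) => _; rewrite !xpair_eqE /=; lia.
  by case: (boolP `[< commute v e >]) => _; rewrite !xpair_eqE /=; lia.
exists w, t; rewrite eq_d; split=> //; have [rt _] := rho_top L.
have /eqP := rt w t (eq_leq (esym eq_d)); rewrite ssubE subr_eq0 => /eqP->.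
by rewrite topsE lrserE => /eqP; rewrite mulf_eq0 => /orP[] /eqP.
Qed.

Lemma lrser_mag_eq1 f e : lser (mag K f) * rser (mag K e) = 1 ->
  f = 1%g /\ e = 1%g.
Proof.
move=> eq1; split; apply: (@mag_inj _ K); rewrite mag1; apply/funext => w.
  by have := congr1 (fun r : R => r [::] w) eq1;
    rewrite /= lrserE mag_nil mulr1.
have := congr1 (fun r : R => r w [::]) eq1; rewrite /= lrserE mag_nil mul1r =>
  ->.
by case: w.
Qed.

(** The series 1 is concentrated at the empty words, so a trivial image has degree 0. All syllables
    are then central, adjacency leaves only one, and the Magnus map is injective on it. *)
Lemma rho_neq1 L : sorted syll_adj L -> (forall s, s \in L -> nontrivial s) ->
  L <> [::] -> rho (wprod syll_word L) <> 1%g.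
Proof.
move=> sL nt L0 eq1; have [w [t]] := rho_coef sL nt; rewrite eq1 ival1.
case: w => [|y w] [le0 nz]; last by case: nz.
case: t le0 nz => [|x t] le0 nz; last by case: nz.
have {le0} : all central L.
  by move: le0; rewrite leqn0 eqn0Ngt -has_count has_predC negbK.
case: L sL nt L0 eq1 => [//|s [|t L]] sL nt _ eq1; last first.
  by move: sL => /= /andP[/andP[_ /negP st] _] /and3P[cs ct _]; case: st;
    rewrite cs.
rewrite /= andbT => cs; move: eq1 (nt s (mem_head _ _)); rewrite /= mulg1.
move=> /(congr1 (@ival _)); rewrite syll_top_central // /syll_top ival1.
case: s cs {sL nt} => /= [f|e] -> /=.
  by rewrite -(mag1 Y K) => /lrser_mag_eq1[f1 _] /(_ f1).
by rewrite -(mag1 X K) => /lrser_mag_eq1[_ e1] /(_ e1).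
Qed.

End Representation.

(** * Shortest syllable words and faithfulness on the amalgam *)

Lemma sorted_adjacent (T : Type) (r : rel T) (L : seq T) :
  (forall L1 s t L2, L = L1 ++ s :: t :: L2 -> r s t) -> sorted r L.
Proof.
elim: L => // s [|t L] IHL rL //=; rewrite (rL [::] s t L) //=.
by apply: IHL => L1 s' t' L2 eqL; apply: (rL (s :: L1)); rewrite eqL.
Qed.

Section Quotients.
Local Open Scope group_scope.

Lemma qproj_repr (G : groupType) (N : normalSubgroup G) (q : quotg N) :
  qproj N (repr q) = q.
Proof. exact: reprK. Qed.

Variables (G H : groupType) (h : UMagmaMorphism.type G H) (D : set G).
Hypothesis hD : forall x, D x -> h x = 1.

Definition qlift (q : quotg (ncl D)) : H := h (repr q).

Lemma qliftE x : qlift (qproj (ncl D) x) = h x.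
Proof.
have /qprojP hx : qproj (ncl D) (repr (qproj (ncl D) x)) = qproj (ncl D) x.
  exact: qproj_repr.
have hker : is_normal_subgroup [set y | h y = 1].
  split; first split=> /= [|y z hy hz|y hy]; first exact: gmulf1.
  - by rewrite gmulfM hy hz mulg1.
  - by rewrite gmulfV hy invg1.
  - by move=> y z /= hy; rewrite gmulfJ hy conj1g.
have := hx _ (conj hker hD) => /=; rewrite gmulfM gmulfV.
by move=> /mulg1_eq; rewrite invgK.
Qed.

Lemma qlift_is_monoid_morphism : monoid.monoid_morphism qlift.
Proof.
split; first by rewrite -[1 in LHS]/(qproj (ncl D) 1) qliftE gmulf1.
move=> x y; rewrite -(qproj_repr x) -(qproj_repr y) -gmulfM !qliftE.
exact: gmulfM.
Qed.

End Quotients.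

Section Faithful.
Local Open Scope group_scope.
Variables (X Y : Type) (K : idomainType) (u : freeGroup X) (v : freeGroup Y).
Hypotheses (npp_u : ~ proper_power u) (npp_v : ~ proper_power v).
Local Notation G := (commuting_amalgam u v).
Local Notation D := [set [~ free_map inl u, free_map inr v]]%classic.
Local Notation pi := (qproj (ncl D)).
Local Notation syll := (freeGroup X + freeGroup Y)%type.
Implicit Types (s t r : syll) (L : seq syll).

Let e s : G := pi (syll_word s).

Lemma wprod_pi L : wprod e L = pi (wprod (@syll_word X Y) L).
Proof. by elim: L => [|s L IHL] /=; rewrite ?gmulf1 // IHL gmulfM. Qed.

Lemma syll_wordP (x : freeGroup (X + Y)) : exists L, wprod (@syll_word X Y) L = x.
Proof.
elim/freeGroup_ind: x => [|[x|y]|x y [L <-] [M <-]|x [L <-]].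
- by exists [::].
- by exists [:: inl (fgen x)]; rewrite /= mulg1 free_map_gen.
- by exists [:: inr (fgen y)]; rewrite /= mulg1 free_map_gen.
- by exists (L ++ M); rewrite wprod_cat.
elim: L => [|s L [M eqM]]; first by exists [::]; rewrite /= invg1.
pose s' : syll := match s with inl f => inl f^-1 | inr f => inr f^-1 end.
exists (M ++ [:: s']); rewrite wprod_cat /= mulg1 eqM invgM /s'.
by case: s {s'} => f /=; rewrite gmulfV.
Qed.

Lemma same_side_merge s t : same_side s t -> exists r, e r = e s * e t.
Proof.
case: s t => [f|f] [g|g] // _; [exists (inl (f * g))|exists (inr (f * g))];
by rewrite /e /= -gmulfM -gmulfM.
Qed.

Lemma is_power_morph (H1 H2 : groupType) (h : UMagmaMorphism.type H1 H2) z x :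
  is_power z x -> is_power (h z) (h x).
Proof. by move=> [n [->|->]]; exists n; [left; rewrite gmulfXn|right;
  rewrite gmulfXVn]. Qed.

Lemma is_power_commute (H : groupType) (a b x y : H) : commute a b ->
  is_power a x -> is_power b y -> commute x y.
Proof.
have wl (c d z : H) : commute c d -> is_power c z -> commute z d.
  move=> cd cz; have [n [->|->]] := cz.
    exact/commute_sym/commuteX/commute_sym.
  exact/commute_sym/commuteV/commuteX/commute_sym.
move=> ab ax yb; apply: (wl a) => //; apply/commute_sym.
by apply: (wl b) => //; apply/commute_sym.
Qed.

Lemma pi_relator : commute (pi (free_map inl u)) (pi (free_map inr v)).
Proof.
apply/commgP/eqP; rewrite -gmulfR -[RHS]/(pi 1); apply/esym/qprojP.
by rewrite invg1 mul1g => N [_ DN]; apply: DN.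
Qed.

(** Central syllables are powers of [u] and of [v], whose images commute by the relator. *)
Lemma central_commute s t : ~~ same_side s t -> central u v s ->
  central u v t ->
  commute (e s) (e t).
Proof.
have wl (f : freeGroup X) (g : freeGroup Y) : commute u f -> commute v g ->
    commute (e (inl f)) (e (inr g)).
  move=> uf vg; apply: is_power_commute pi_relator _ _;
    do 2!apply: is_power_morph.
    exact: centralizer_power npp_u uf.
  exact: centralizer_power npp_v vg.
case: s t => [f|f] [g|g] //= _ /asboolP cf /asboolP cg; first exact: wl.
exact/commute_sym/wl.
Qed.

Lemma same_side_trans s t r : ~~ same_side s t -> ~~ same_side t r ->
  same_side s r.
Proof. by case: s t r => [f|f] [g|g] []. Qed.

(** Two adjacent central syllables can be exchanged at no cost in length. A third syllable beside
    them would then meet one from its own side and merge with it, so there is none. *)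
Lemma geodesic_adj L : geodesic e L -> sorted (syll_adj u v) L \/
  exists s t, [/\ L = [:: s;
    t], ~~ same_side s t, central u v s & central u v t].
Proof.
move=> geoL.
have alt L' L1 s t L2 : geodesic e L' -> L' = L1 ++ s :: t :: L2 ->
  ~~ same_side s t.
  move=> geoL' eqL; apply/negP => st; rewrite eqL in geoL'.
  exact: geodesic_merge geoL' (same_side_merge st).
have [size2|size2] := eqVneq (size L) 2%N.
  case: L geoL size2 => [|s [|t []]] // geoL _.
  have st : ~~ same_side s t by apply: (alt _ [::] s t [::] geoL).
  have [/andP[cs ct]|ncst] := boolP (central u v s && central u v t).
    by right; exists s, t.
  by left; rewrite /= /syll_adj st ncst.
left; apply: sorted_adjacent => L1 s t L2 eqL.
have st := alt _ _ _ _ _ geoL eqL; rewrite /syll_adj st /=.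
apply/negP => /andP[cs ct]; have eC := central_commute st cs ct.
have geoL' : geodesic e (L1 ++ t :: s :: L2).
  move=> L'; rewrite (_ : wprod e (L1 ++ _) = wprod e L).
    by move=> /geoL; rewrite eqL !size_cat.
  by rewrite eqL !wprod_cat /= !mulgA -(mulgA _ (e t)) -eC !mulgA.
case: L2 => [|r L2] in eqL geoL' *.
  case/lastP: L1 => [|L1 r] in eqL geoL' *; first by rewrite eqL in size2.
  have rs : ~~ same_side r s by apply: (alt _ L1 r s [:: t] geoL);
    rewrite eqL -cats1 -catA.
  have : ~~ same_side r t.
    by apply: (alt _ L1 r t [:: s] geoL'); rewrite -cats1 -catA.
  by rewrite (same_side_trans rs st).
have tr : ~~ same_side t r.
  by apply: (alt _ (rcons L1 s) t r L2 geoL); rewrite eqL -cats1 -catA.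
have : ~~ same_side s r.
  by apply: (alt _ (rcons L1 t) s r L2 geoL'); rewrite -cats1 -catA.
by rewrite (same_side_trans st tr).
Qed.

Definition amalgam_rho : G -> invertible (series (option {classic Y})
  (series (option {classic X}) K)) :=
  @qlift _ _ (rho K u v) D.

Lemma amalgam_rhoE x : amalgam_rho (pi x) = rho K u v x.
Proof. by apply: qliftE => _ ->; apply: rho_relator. Qed.

Lemma amalgam_rho_is_monoid_morphism : monoid.monoid_morphism amalgam_rho.
Proof. by apply: qlift_is_monoid_morphism => _ ->; apply: rho_relator. Qed.
HB.instance Definition _ := isUMagmaMorphism.Build G
  (invertible (series (option {classic Y}) (series (option {classic X}) K)))
  amalgam_rho amalgam_rho_is_monoid_morphism.

Lemma amalgam_rho_neq1 (g : G) : g <> 1 -> amalgam_rho g <> 1.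
Proof.
have [L0 <-] : exists L, wprod e L = g.
  have [L eqL] := syll_wordP (repr g); exists L.
  by rewrite wprod_pi eqL qproj_repr.
have [L <- geoL] := geodesicP e L0 => {L0} g1.
have nt s : s \in L -> nontrivial s.
  move=> sL; case/splitPr: sL g1 geoL => L1 L2 _ geoL;
    move: (geodesic_neq1 geoL) => {geoL} es1.
  by case: s es1 => f /= es1 f1; apply: es1; rewrite /e /= f1 !gmulf1.
have L0 : L <> [::] by move=> eqL; apply: g1; rewrite eqL.
rewrite wprod_pi amalgam_rhoE; case: (geodesic_adj geoL) => [sL|].
  exact: rho_neq1.
(* The exceptional pair maps to a product of an X-series and a Y-series, and [lrser_mag_eq1]
   recovers each factor. *)
move=> [s [t [eqL st cs ct]]]; rewrite eqL /= mulg1 => /(congr1 (@ival _)).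
rewrite gmulfM ivalM !syll_top_central // ival1 /syll_top => eq1.
have ns : nontrivial s by apply: nt; rewrite eqL mem_head.
case: s t st cs ct ns eq1 {eqL} => [f|f] [f2|f2] //= _ -> -> f1.
  by rewrite rser1 lser1 mulr1 mul1r => /lrser_mag_eq1[].
by rewrite rser1 lser1 mulr1 mul1r -lrserC => /lrser_mag_eq1[_].
Qed.

End Faithful.

(** * Congruence subgroups of a filtered ring *)

Section FiniteCopy.
Variables (Q : groupType) (T : finType) (f : Q -> T) (g : T -> option Q).
Hypothesis fK : pcancel f g.
Local Open Scope group_scope.

(** A copy of [Q] indexed by the encoding, on which the finite group structure, and hence Cauchy's
    theorem, is available. *)
Definition fin_copy of pcancel f g : Type := Q.
Local Notation finQ := (fin_copy fK).
HB.instance Definition _ := Finite.copy finQ (pcan_type fK).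
HB.instance Definition _ := Finite_isGroup.Build finQ (@mulgA Q) (@mul1g Q)
  (@mulVg Q).

(** By Cauchy, a prime dividing the order is the order of an element, hence divides [p ^ s] and
    equals [p]. *)
Lemma finite_pgroup_pcan (p s : nat) : prime p ->
  (forall x : Q, x ^+ (p ^ s) = 1) -> finite_pgroup p Q.
Proof.
move=> p_pr expQ; have pX (x : finQ) : x ^+ (p ^ s) = 1.
  by rewrite -[RHS](expQ x); elim: (p ^ s)%N => // n IHn;
    rewrite expgS IHn -expgS.
have [k cardQ] : {k | #|[set: finQ]| = (p ^ k)%N}.
  apply: p_natP; apply/pnatP => // q q_pr /(Cauchy q_pr)[x _ ox].
  have : (#[x] %| p ^ s)%N by rewrite order_dvdn pX.
  by rewrite ox Euclid_dvdX // dvdn_prime2 // => /andP[].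
exists k; apply/card_set_bijP; exists (fun q : Q =>
  nat_of_ord (enum_rank (q : finQ))); split.
- by move=> q _ /=; rewrite -cardQ cardsT.
- by move=> q r _ _ /ord_inj/enum_rank_inj.
move=> i /=; rewrite -cardQ cardsT => lt_i.
by exists (enum_val (Ordinal lt_i)) => //; rewrite enum_valK.
Qed.


End FiniteCopy.

Lemma finite_pgroup_inj (Q : groupType) (T : finType) (f : Q -> T) (p s : nat) :
  injective f -> prime p -> (forall x : Q, x ^+ (p ^ s) = 1)%g ->
    finite_pgroup p Q.
Proof.
move=> f_inj; pose g t :=
  if pselect (exists q, f q = t) is left q then Some (projT1 (cid q)) else None.
apply: (@finite_pgroup_pcan _ _ f g) => q; rewrite /g.
case: pselect => [qP|[]]; last by exists q.
by congr Some; apply: f_inj; case: (cid qP).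
Qed.

Lemma exprD1n_sqr (R : nzRingType) (a : R) k :
  exists c, (1 + a) ^+ k = 1 + a *+ k + a * a * c.
Proof.
elim: k => [|k [c IHk]]; first by exists 0; rewrite mulr0 !addr0.
exists (c + (1 *+ k + a * c)); rewrite exprS IHk mulrDl mul1r.
have -> : a * (1 + a *+ k + a * a * c) = a + (a * a *+ k + a * a * (a * c)).
  by rewrite !mulrDr mulr1 mulrnAr !mulrA -addrA.
by rewrite addrACA -[1 + _ + a]addrA [a *+ k + a]addrC -mulrS !mulrDr mulrnAr mulr1.
Qed.

Record filtration (R : nzRingType) (F : nat -> R -> Prop) : Prop := Filtration {
  filtration_top : forall r, F 0 r;
  filtration0 : forall n, F n 0;
  filtrationB : forall n r s, F n r -> F n s -> F n (r - s);
  filtrationM : forall m n r s, F m r -> F n s -> F (m + n) (r * s);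
  filtrationS : forall n r, F n.+1 r -> F n r }.

Section Filtration.
Variables (R : nzRingType) (F : nat -> R -> Prop).
Hypothesis filtF : filtration F.

Let F0 : forall r, F 0 r. Proof. by case: filtF. Qed.
Let F_0 : forall n, F n 0. Proof. by case: filtF. Qed.
Let FB n r s : F n r -> F n s -> F n (r - s).
Proof. by case: filtF => _ _ FB _ _; apply: FB. Qed.
Let FM m n r s : F m r -> F n s -> F (m + n) (r * s).
Proof. by case: filtF => _ _ _ FM _; apply: FM. Qed.
Let FS n r : F n.+1 r -> F n r.
Proof. by case: filtF => _ _ _ _; apply. Qed.
Let FN n r : F n r -> F n (- r).
Proof. by move=> Fr; rewrite -[- r]sub0r; apply: FB. Qed.
Let FD n r s : F n r -> F n s -> F n (r + s).
Proof. by move=> Fr Fs; rewrite -[s]opprK; apply/FB/FN. Qed.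
Let FMl n r s : F n s -> F n (r * s).
Proof. by move=> Fs; apply: (@FM 0). Qed.
Let FMr n r s : F n r -> F n (r * s).
Proof. by move=> Fr; rewrite -[n]addn0; apply: FM. Qed.
Let FW m n r : (m <= n)%N -> F n r -> F m r.
Proof. by move/subnK <-; elim: (n - m)%N => // k IHk /FS. Qed.

Variables (G : groupType) (h : UMagmaMorphism.type G (invertible R)).
Hypothesis h1 : forall g, F 1 (ival (h g) - 1).

Definition congruence (n : nat) : set G := [set g | F n (ival (h g) - 1)].

Let mulB1 (a b : R) : a * b - 1 = (a - 1) * b + (b - 1).
Proof. by rewrite mulrBl mul1r addrA subrK. Qed.

Lemma congruence_normal n : is_normal_subgroup (congruence n).
Proof.
have cV g : congruence n g -> congruence n g^-1%g.
  rewrite /congruence /= gmulfV => Fg.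
  have -> : ival (h g)^-1%g - 1 = - (ival (h g)^-1%g * (ival (h g) - 1)).
    by rewrite mulrBr ivalVK mulr1 opprB.
  exact/FN/FMl.
split; first split=> [|x y|x]; rewrite /congruence /=.
- by rewrite gmulf1 ival1 subrr.
- by move=> Fx Fy; rewrite gmulfM ivalM mulB1; apply: FD => //; apply: FMr.
- exact: cV.
move=> x y Fx; rewrite /congruence /= gmulfJ conjgE !ivalM.
rewrite -[X in _ - X](ivalVK (h y)) -mulrBr -[X in _ - X]mul1r -mulrBl.
by apply/FMl/FMr.
Qed.

(** Degrees add because [[a, b] - 1 = a^-1 b^-1 ((a - 1)(b - 1) - (b - 1)(a - 1))]. *)
Lemma gamma_congruence n g : gamma G n.+1 g -> congruence n.+1 g.
Proof.
elim: n g => [|n IHn] g; first by move=> _; apply: h1.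
apply; split; first by case: (congruence_normal n.+2).
move=> _ [x [y [_ /IHn Fy ->]]]; rewrite /congruence /= gmulfR.
set a := h x; set b := h y;
  have aE : (ival a - 1) * (ival b - 1) - (ival b - 1) * (ival a - 1) =
      ival a * ival b - ival b * ival a.
  have subE (c d : R) : (c - 1) * (d - 1) = c * d - (c + d - 1).
    by rewrite mulrBl mulrBr mulr1 mul1r -addrA -opprD addrA.
  by rewrite !subE [ival b + _]addrC [- (_ - (_ - 1))]opprB addrA subrK.
have -> : ival [~ a, b]%g - 1 =
    ival (a^-1 * b^-1)%g *
      ((ival a - 1) * (ival b - 1) - (ival b - 1) * (ival a - 1)).
  rewrite aE mulrBr -!ivalM; congr (_ - _);
    first by rewrite /commg conjgE !mulgA.
  by rewrite !mulgA mulgVK mulVg.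
apply: FMl; apply: FB; first by apply: (@FM 1); [apply: h1|apply: Fy].
by rewrite -addn1; apply: (@FM n.+1 1); [apply: Fy|apply: h1].
Qed.

Definition congruence_nsg n : normalSubgroup G :=
  NormalSubgroup (congruence_normal n).


Lemma congruence_nilpotent n : nilpotent_group (quotg (congruence_nsg n.+1)).
Proof.
exists n; pose N := congruence_nsg n.+1.
suff gammaQ m q : gamma (quotg N) m.+1 q ->
    exists2 g, gamma G m.+1 g & q = qproj N g.
  apply/seteqP; split=> [q /gammaQ[g /gamma_congruence Ng ->]|_ ->] /=.
    by rewrite -[RHS]/(qproj N 1%g); apply/esym/qprojP; rewrite invg1 mul1g.
  by have [[]] := gamma_normal (quotg N) n.+1.
elim: m q => [|m IHm] q; first by exists (repr q); rewrite ?qproj_repr.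
move=> gq;
  apply: (gq [set q | exists2 g, gamma G m.+2 g & q = qproj N g]%classic);
    split.
  have [[g1 gM gV] _] := gamma_normal G m.+2.
  split=> [|_ _ [x gx ->] [y gy ->]|_ [x gx ->]].
  - by exists 1%g.
  - by exists (x * y)%g; [apply: gM|rewrite gmulfM].
  - by exists x^-1%g; [apply: gV|rewrite gmulfV].
move=> _ [a [_ [_ /IHm[y gy ->] ->]]]; exists [~ repr a, y]%g.
  by move=> B [_]; apply; exists (repr a), y.
by rewrite gmulfR /= qproj_repr.
Qed.

Let ivalX (x : invertible R) k : ival (x ^+ k)%g = ival x ^+ k.
Proof. by elim: k => // k IHk; rewrite expgS ivalM IHk exprS. Qed.

(** With [a = h g - 1], the power [(1 + a)^m - 1] is [m a] modulo multiples of [a^2]. If [a] has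
    degree [i >= 1], then [a^2] has degree [2i >= i + 1], so [m a], hence [a], has degree [i + 1] as
    long as this is at most [n]. *)
Lemma congruence_torsion_free n :
  (forall i m r, (0 < m)%N -> F i (r *+ m) -> F i r) ->
  torsion_free (quotg (congruence_nsg n)).
Proof.
move=> Ftf x m m_gt0; rewrite -(qproj_repr x); move: (repr x) => g.
rewrite -gmulfXn -[1%g]/(qproj (congruence_nsg n) 1%g) => /esym/qprojP.
rewrite invg1 mul1g /= /congruence /= gmulfXn ivalX => Fgm.
apply/esym/qprojP; rewrite invg1 mul1g /= /congruence /=.
set a := ival (h g) - 1.
have [c] := exprD1n_sqr a m; rewrite [1 + a]addrC subrK => eq_c.
suff Fa i : (i <= n)%N -> F i a by apply: Fa.
elim: i => [|[|i] IHi] le_in; [exact: F0|exact: h1|].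
apply: (Ftf _ m) => //; have -> : a *+ m = ival (h g) ^+ m - 1 - a * a * c.
  by rewrite eq_c addrAC addrK addrAC subrr add0r.
apply: FB; first exact: FW Fgm.
apply/FMr/(FW _ (FM (IHi _) (IHi _))); lia.
Qed.

(** By Frobenius [a^(p^s) - 1 = (a - 1)^(p^s)], which has degree at least [p^s]. *)
Lemma congruence_exponent p s n : p \in [pchar R] -> (n <= p ^ s)%N ->
  forall x : quotg (congruence_nsg n), (x ^+ (p ^ s) = 1)%g.
Proof.
move=> charRp le_n x; rewrite -(qproj_repr x); move: (repr x) => g.
rewrite -gmulfXn; apply/esym/qprojP; rewrite invg1 mul1g /= /congruence /=.
rewrite gmulfXn ivalX; apply: FW le_n _; set a := ival (h g).
have -> : a ^+ (p ^ s) - 1 = (a - 1) ^+ (p ^ s).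
  elim: s => [|s IHs]; first by rewrite !expr1.
  rewrite expnSr !exprM -IHs -!(pFrobenius_autE charRp) pFrobenius_autB_comm.
    by rewrite pFrobenius_aut1.
  exact: commr1.
elim: (p ^ s)%N => [|k IHk]; first exact: F0.
by rewrite exprS; apply: (@FM 1) => //; apply: h1.
Qed.

(** Cosets are separated since [b^-1 a - 1 = b^-1 (a - b)]. *)
Lemma congruence_inj (T : Type) (phi : R -> T) n :
  (forall r s, phi r = phi s -> F n (r - s)) ->
  injective (fun q : quotg (congruence_nsg n) => phi (ival (h (repr q)))).
Proof.
move=> phiF x y /phiF; rewrite -{2}(qproj_repr x) -{2}(qproj_repr y).
move: (repr x) (repr y) => {x y} a b Fab; apply/esym/qprojP.
rewrite /= /congruence /= gmulfM ivalM gmulfV -(ivalVK (h b)) -mulrBr.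
exact: FMl.
Qed.

End Filtration.

(** * Filtration by word length in finitely many letters *)

Section WordFiltration.
Variables (S T : eqType) (K : nzRingType) (ls : seq S) (lt : seq T).
Local Notation R := (series T (series S K)).
Implicit Types (r s : R).

(** Restricting to listed letters is compatible with products, as the pieces of a word use the same
    letters, and leaves finitely many coefficients to test even for infinite alphabets. *)
Definition word_filtration (n : nat) r : Prop :=
  forall w t, all (mem lt) w -> all (mem ls) t -> (size w + size t < n)%N ->
    r w t = 0.

Lemma word_filtrationP : filtration word_filtration.
Proof.
split=> [//|n w t //|n r s Fr Fs w t *
  |m n r s Fr Fs w t aw at_ lt_mn|n r Fr w t aw at_ lt_n].
- by rewrite !ssubE Fr ?Fs ?subr0.
- apply: (smul_sumP (P := fun a : series S K => a t = 0)) => //.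
    by move=> a b; rewrite saddE => -> ->; rewrite addr0.
  move=> w1 w2 eq_w; apply: smul0P => t1 t2 eq_t; move: aw at_ lt_mn.
  rewrite eq_w eq_t !all_cat !size_cat => /andP[aw1 aw2] /andP[at1 at2] lt_mn.
  have [le_m|lt_m] := leqP m (size w1 + size t1); last by rewrite Fr ?mul0r.
  by rewrite Fs ?mulr0 //; lia.
- by apply: Fr => //; apply: ltnW.
Qed.

Lemma series_mulrnE (S' : Type) (K' : nzRingType) (f : series S' K') m w :
  (f *+ m) w = f w *+ m.
Proof. by elim: m => // m IHm; rewrite !mulrS saddE IHm. Qed.

End WordFiltration.

Lemma map_val_seq_sub (S : choiceType) (l w : seq S) : all (mem l) w ->
  exists s : seq (seq_sub l), map val s = w.
Proof.
elim: w => [|x w IHw] /=; first by exists [::].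
by case/andP=> lx /IHw[s <-]; exists (SeqSub lx :: s).
Qed.

Lemma word_filtration_finite (S T : choiceType) (K : finNzRingType)
    (ls : seq S) (lt : seq T) n :
  exists (U : finType) (phi : series T (series S K) -> U),
    forall r s, phi r = phi s -> word_filtration ls lt n (r - s).
Proof.
exists {ffun {bseq n of seq_sub lt} * {bseq n of seq_sub ls} -> K}.
exists (fun r => [ffun p => r (map val (val p.1)) (map val (val p.2))]).
move=> r s /ffunP eq_rs w t /map_val_seq_sub[w' <-] /map_val_seq_sub[t' <-].
rewrite !size_map => lt_n; have lew : (size w' <= n)%N :=
  ltnW (leq_ltn_trans (leq_addr _ _) lt_n).
have let_ : (size t' <= n)%N := ltnW (leq_ltn_trans (leq_addl _ _) lt_n).
by have := eq_rs (Bseq lew, Bseq let_); rewrite !ffunE /= !ssubE => ->;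
  rewrite subrr.
Qed.

(** * Residual properties of the amalgam *)

Section Residual.
Variables (X Y : Type) (K : idomainType) (u : freeGroup X) (v : freeGroup Y).
Hypotheses (npp_u : ~ proper_power u) (npp_v : ~ proper_power v).
Local Notation SX := (option {classic X}).
Local Notation SY := (option {classic Y}).
Local Notation R := (series SY (series SX K)).
Local Notation G := (commuting_amalgam u v).

(** The constant coefficient is multiplicative with values in the commutative [K], so it does not
    see the conjugations. *)
Lemma amalgam_rho_nil (g : G) : ival (amalgam_rho K g) [::] [::] = 1.
Proof.
pose c (x : invertible R) := ival x [::] [::].
have cM x y : c (x * y)%g = c x * c y by rewrite /c ivalM !smulE0.
have c1 : c 1%g = 1 by [].
have cJ x y : c (x ^ y)%g = c x.
  by rewrite conjgE !cM mulrC -mulrA -cM mulgV c1 mulr1.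
rewrite -(qproj_repr g) amalgam_rhoE -/(c _); elim/freeGroup_ind: (repr g).
- by rewrite gmulf1.
- move=> [x|y]; rewrite -free_map_gen ?rho_inl ?rho_inr cJ /c /ival /=.
    exact: mag_nil.
  by rewrite /rser /smap /= mag_nil.
- by move=> x y cx cy; rewrite gmulfM cM cx cy mulr1.
move=> x cx; have := cM (rho K u v x) (rho K u v x)^-1%g.
by rewrite mulgV c1 cx mul1r gmulfV.
Qed.

Lemma amalgam_rho_filtration (ls : seq SX) (lt : seq SY) (g : G) :
  word_filtration ls lt 1 (ival (amalgam_rho K g) - 1).
Proof.
by move=> [|y w] [|x t] //= _ _ _; rewrite !ssubE amalgam_rho_nil subrr.
Qed.

Definition amalgam_nsg (ls : seq SX) (lt : seq SY)
  (n : nat) : normalSubgroup G :=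
  congruence_nsg (word_filtrationP K ls lt) (@amalgam_rho X Y K u v) n.

Lemma amalgam_separation (g : G) : g <> 1%g ->
  exists (ls : seq SX) (lt : seq SY) n, ~ amalgam_nsg ls lt n.+1 g.
Proof.
move=> /(amalgam_rho_neq1 (K := K) npp_u npp_v) g1.
have [w] : exists w, (ival (amalgam_rho K g) - 1) w <> 0.
  apply: series_neq0 => /eqP; rewrite subr_eq0 => /eqP eq1.
  by apply: g1; apply: ival_inj; rewrite ival1.
(* The words of a nonzero coefficient serve as the lists of letters, and their total length as the
   degree. *)
move=> /series_neq0[t nz]; exists t, w, (size w + size t)%N => Fg.
by apply: nz; apply: Fg => //; apply/allP.
Qed.

End Residual.

Lemma amalgam_residually_p (X Y : Type) (u : freeGroup X) (v : freeGroup Y) p :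
  ~ proper_power u -> ~ proper_power v -> prime p ->
  residually (finite_pgroup p) (commuting_amalgam u v).
Proof.
move=> npp_u npp_v p_pr g g1.
have [ls [lt [n Ng]]] := amalgam_separation 'F_p npp_u npp_v g1.
exists (amalgam_nsg 'F_p u v ls lt n.+1); split=> //.
have [U [phi phiF]] := word_filtration_finite 'F_p ls lt n.+1.
apply: (finite_pgroup_inj (s := n.+1) (congruence_inj (filtF :=
  word_filtrationP _ ls lt) (h := amalgam_rho 'F_p (u:=u) (v:=v)) phiF) p_pr).
have charR : p \in [pchar (series (option {classic Y})
  (series (option {classic X}) 'F_p))].
  apply: (rmorph_pchar (@sconst _ (series _ 'F_p))).
  by apply: (rmorph_pchar (@sconst _ 'F_p)); apply: pchar_Fp.
have le_n : (n.+1 <= p ^ n.+1)%N by apply/ltnW/ltn_expl/prime_gt1.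
exact: (@congruence_exponent _ _ (word_filtrationP 'F_p ls lt) _
  (@amalgam_rho X Y 'F_p u v)
  (@amalgam_rho_filtration _ _ _ _ _ _ _)).
Qed.

Lemma amalgam_residually_tfn (X Y : Type) (u : freeGroup X) (v : freeGroup Y) :
  ~ proper_power u -> ~ proper_power v ->
  residually torsion_free_nilpotent (commuting_amalgam u v).
Proof.
move=> npp_u npp_v g g1.
have [ls [lt [n Ng]]] := amalgam_separation rat npp_u npp_v g1.
exists (amalgam_nsg rat u v ls lt n.+1); split=> //; split.
  apply: congruence_torsion_free; first exact: amalgam_rho_filtration.
  move=> i m r m_gt0 Fr w t aw at_ lt_i; have /eqP := Fr w t aw at_ lt_i.
  by rewrite !series_mulrnE Num.Theory.mulrn_eq0 eqn0Ngt m_gt0 => /eqP.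
by apply: congruence_nilpotent; apply: amalgam_rho_filtration.
Qed.

Local Open Scope classical_set_scope.
Local Open Scope group_scope.

Theorem theorem5 (X Y : Type) (u : freeGroup X) (v : freeGroup Y)
    (hu : ~ proper_power u) (hv : ~ proper_power v) :
  [/\ forall p : nat, prime p ->
        residually (finite_pgroup p) (commuting_amalgam u v),
      forall j k : nat, (1 <= j)%N -> (1 <= k)%N ->
        gamma (freeGroup X) j u -> ~ gamma (freeGroup X) j.+1 u ->
        gamma (freeGroup Y) k v -> ~ gamma (freeGroup Y) k.+1 v ->
        ~ proper_power_mod j u -> ~ proper_power_mod k v ->
        residually torsion_free_nilpotent (commuting_amalgam u v)
    & [set: X] !=set0 -> finite_set [set: X] ->
      [set: Y] !=set0 -> finite_set [set: Y] ->
      basic_commutator u -> basic_commutator v ->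
      residually torsion_free_nilpotent (commuting_amalgam u v)].
Proof.
split=> [p p_pr|j k _ _ _ _ _ _ _ _|_ _ _ _ _ _].
- exact: amalgam_residually_p.
- exact: amalgam_residually_tfn.
- exact: amalgam_residually_tfn.
Qed.
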